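(* Let $n\ge 2$ be an integer, let $\beta$ be the positive solution of $\beta^n=1+\beta+\cdots+\beta^{n-1}$, and let $X$ be an absolutely continuous random variable with probability density function $f$ concentrated on $[0,1)$. For $m\in\mathbb N$ let $P_m$ be the distribution of $t^m(X)$ and let $f_m$ be its density, and let $P_\beta$ be the probability distribution on $[0,1)$ with density $f_\beta$ (all as defined in the context). Then $$\lim_{m\to\infty} d_{TV}(P_m,P_\beta)=0.$$ In addition, if $f$ is a Lipschitz function with $|f(x)-f(y)|\le L_f|x-y|$ for all $x,y\in[0,1)$, then for any integer $m>2n$ $$\|f_m-f_\beta\|_\infty = O\big(|\beta^{-1}\lambda_2|^{m_2}\big)+O\big(\beta^{-m_1}\big)L_f$$ whenever $m_1,m_2\in\mathbb N$ satisfy $m_2>2n-1$, $m_1\ge n-1$ and $m_1+m_2=m$; that is, there is a constant $C$ depending only on $n$ such that $\|f_m-f_\beta\|_\infty\le C|\beta^{-1}\lambda_2|^{m_2}+C\beta^{-m_1}L_f$ for all such $m,m_1,m_2$.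
   Context: $\mathbb N=\{1,2,\dots\}$. The equation $\beta^n=1+\beta+\cdots+\beta^{n-1}$ has a unique positive solution $\beta$, and $1<\beta<2$. $\lambda_2$ denotes a root of $p(x)=x^n-(1+x+\cdots+x^{n-1})$ with the second largest absolute value among all $n$ complex roots (the root of largest absolute value is $\beta$). For $x\in[0,1)$ put $t(x)=\beta x-\lfloor\beta x\rfloor\in[0,1)$, $t^0(x)=x$, and let $t^m$ be the $m$-fold composition of $t$ with itself. (With $X_k=\lfloor\beta t^{k-1}(X)\rfloor\in\{0,1\}$, one has $X=\sum_{k\ge1}X_k\beta^{-k}$ and $t^m(X)=\sum_{k\ge1}X_{m+k}\beta^{-k}$ is the scaled remainder.) $\mathcal B$ denotes the Borel subsets of $[0,1)$. $P_m(B)=P(t^m(X)\in B)$ for $B\in\mathcal B$. The density $f_m$ of $P_m$ is the version given for every $x\in[0,1)$ by $$f_m(x)=\beta^{-m}\sum_{J\in\Omega_m}\chi_{[0,K(J))}(x)\,f(L_{J,m}+\beta^{-m}x),$$ where $\chi_I$ is the indicator function of $I$; $\Omega_m$ is the set of all $J=(j_1,\dots,j_m)\in\{0,1\}^m$ in which no more than $n-1$ of the $j_k$'s in succession equal $1$; $L_{J,m}=\sum_{k=1}^m j_k\beta^{-k}$; $r(J)$ is the number of $1$'s in succession at the end of $J$; and $K(J)=\beta^{-1}+\cdots+\beta^{-(n-r(J))}$. For $0\le x<1$, $$f_\beta(x)=D(\beta)^{-1}\sum_{j=1}^n F_j(x),\qquad F_j=(\beta^j-\beta^{j-1}-\beta^{j-2}-\cdots-\beta)\,\chi_{[\beta^{-1}+\cdots+\beta^{-(j-1)},\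 \beta^{-1}+\cdots+\beta^{-j})},$$ where for $j=1$ the coefficient is $\beta$ and the interval is $[0,\beta^{-1})$, and $D(\beta)$ is the constant such that $\int_{[0,1)}f_\beta(x)\,dx=1$. $P_\beta(B)=\int_B f_\beta(x)\,dx$ for $B\in\mathcal B$. The total variation distance is $d_{TV}(P_1,P_2)=\sup_{B\in\mathcal B}|P_1(B)-P_2(B)|$, and $\|h-f_\beta\|_\infty=\sup_{x\in[0,1)}|h(x)-f_\beta(x)|$. *)

(* Defs.v *)
From HB Require Import structures.
From mathcomp Require Import all_boot all_order all_algebra.
From mathcomp Require Import complex.
From mathcomp Require Import all_classical all_reals all_analysis.

Set Implicit Arguments.
Unset Strict Implicit.
Unset Printing Implicit Defensive.

Import Order.TTheory GRing.Theory Num.Theory.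
Import numFieldNormedType.Exports.
Import ComplexField.Normc.

Local Open Scope classical_set_scope.
Local Open Scope ring_scope.

Definition nbonacci_base (R : realType) (n : nat) (beta : R) : Prop :=
  0 < beta /\ beta ^+ n = \sum_(i < n) beta ^+ i.

Definition nbonacci_poly (R : realType) (n : nat) : {poly R[i]} :=
  'X^n - \sum_(i < n) 'X^i.

(* The sequence s lists all n complex roots with multiplicity, by nonincreasing
   modulus. *)
Definition second_largest_root (R : realType) (n : nat) (l : R[i]) : Prop :=
  exists s : seq R[i],
    [/\ nbonacci_poly R n = \prod_(z <- s) ('X - z%:P),
        sorted (fun z w => normc w <= normc z) s &
        l = s`_1].

(* Total extension to R of the map on [0, 1); the variables it is applied to
   lie in [0, 1) almost surely. *)
Definition beta_map (R : realType) (beta x : R) : R :=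
  beta * x - (Num.floor (beta * x))%:~R.

Definition density01 (R : realType) (d : measure_display) (T : measurableType d)
    (P : probability T R) (X : {RV P >-> R}) (f : R -> R) : Prop :=
  [/\ measurable_fun setT f,
      forall x, 0 <= f x,
      forall x, x \notin `[0, 1[ -> f x = 0 &
      forall A : set R, measurable A ->
        distribution P X A = (\int[lebesgue_measure]_(x in A) (f x)%:E)%E].

Definition remainder_law (R : realType) (d : measure_display)
    (T : measurableType d) (P : probability T R) (X : {RV P >-> R})
    (beta : R) (m : nat) : set R -> \bar R :=
  pushforward P (fun w => iter m (beta_map beta) (X w)).

(* beta^-1 + ... + beta^-k *)
Definition inv_powers (R : realType) (beta : R) (k : nat) : R :=
  \sum_(1 <= i < k.+1) beta ^- i.

Definition words (n m : nat) : {set m.-tuple bool} :=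
  [set J : m.-tuple bool | ~~ infix (nseq n true) J]%SET.

Definition word_value (R : realType) (beta : R) (m : nat) (J : m.-tuple bool)
    : R :=
  \sum_(k < m) (tnth J k)%:R * beta ^- k.+1.

(* The number of consecutive ones at the end of J. *)
Definition trailing_ones (m : nat) (J : m.-tuple bool) : nat :=
  find negb (rev J).

Definition remainder_density (R : realType) (n : nat) (beta : R) (f : R -> R)
    (m : nat) (x : R) : R :=
  beta ^- m * \sum_(J in words n m)
    \1_[set` `[0, inv_powers beta (n - trailing_ones J)[] x
    * f (word_value beta J + beta ^- m * x).

Definition parry_step (R : realType) (beta : R) (j : nat) (x : R) : R :=
  (beta ^+ j - \sum_(1 <= i < j) beta ^+ i)
  * \1_[set` `[inv_powers beta j.-1, inv_powers beta j[] x.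

(* The value for which parry_density integrates to 1 over [0, 1). *)
Definition parry_const (R : realType) (n : nat) (beta : R) : R :=
  \int[lebesgue_measure]_(x in [set` `[0, 1[])
    (\sum_(1 <= j < n.+1) parry_step beta j x).

Definition parry_density (R : realType) (n : nat) (beta x : R) : R :=
  (parry_const n beta)^-1 * \sum_(1 <= j < n.+1) parry_step beta j x.

Definition parry_law (R : realType) (n : nat) (beta : R) (B : set R) : \bar R :=
  \int[lebesgue_measure]_(x in B) (parry_density n beta x)%:E.

Definition dTV01 (R : realType) (P Q : set R -> \bar R) : \bar R :=
  ereal_sup [set (`| P B - Q B |)%E |
    B in [set B : set R | measurable B /\ B `<=` [set` `[0, 1[]]].

Definition sup_dist01 (R : realType) (g h : R -> R) : \bar R :=
  ereal_sup [set (`| g x - h x |)%:E | x in [set` `[0, 1[]].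

(* Main.v *)
Require Import Defs.
From mathcomp Require Import all_boot all_order all_algebra.
From mathcomp Require Import complex separable ring lra zify.
From mathcomp Require Import all_classical all_reals all_analysis measurable_realfun.

Import Order.TTheory GRing.Theory Num.Theory.
Import numFieldNormedType.Exports.
Import ComplexField.Normc.

Local Open Scope classical_set_scope.
Local Open Scope ring_scope.

(** If [X] has density [f], then [t X] has density [T f], where
[T f (x) = beta^-1 (f (x / beta) + f ((1 + x) / beta))] on [0, 1) is the
transfer operator of [t] ([transfer]), and the formula defining [f_m] is an
expansion of [T^m f] ([remainder_densityE]): the words list the branches of
[t^m].

Put [e_j = beta^-1 + ... + beta^-j]. Since [beta * e_(j+1) = 1 + e_j], the
branches of [t] map the pieces [[e_j, e_(j+1))], [j < n], onto unions of pieces,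
so [T] preserves the functions that are constant on each piece, and acts there
as a companion matrix divided by [beta] ([transfer_step]). Along its orbits the
value on the first piece, multiplied by [beta ^+ k], satisfies the n-bonacci
recurrence [w (k + n) = w k + ... + w (k + n - 1)], and the other values are
sums of consecutive terms of that sequence. The roots of the characteristic
polynomial are simple, and [beta] strictly dominates the others
([nbonacci_simple], [lt_normc_root]); hence [w k = A beta^k + O(rho^k)], where
[rho] is the largest modulus of the other roots ([nbonacci_spectral]). So [T^k]
of a step function converges to a multiple of the fixed point [f_beta] at the
rate [(rho / beta)^k], without polynomial factor ([step_spectral]).

A general [f] is brought to that case by its oscillation. The branches contract
by [beta] and map pieces into pieces, so after [m1] steps [T^m1 f] varies on
each piece by at most a constant times the oscillation of [f] at the scale
[beta^-m1] ([iter_transfer_osc]). Replacing [T^m1 f] by a step function, and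
using that [T] preserves integrals to find the multiple of [f_beta], gives the
uniform estimate [transfer_spectral], which contains the Lipschitz case. For an
arbitrary density, [f] is approximated in [L^1] by a function that is uniformly
continuous on [0, 1); as [T] is positive and preserves integrals it does not
increase the [L^1] distance, and convergence in total variation follows
([transfer_cvg_TV]). *)

(** * Sums of inverse powers of the base *)

Section Base.
Context {R : realType}.
Implicit Types (x b : R) (n k : nat).

Lemma inv_powersS b k : inv_powers b k.+1 = inv_powers b k + b ^- k.+1.
Proof. by rewrite /inv_powers big_nat_recr. Qed.

Lemma inv_powers0 b : inv_powers b 0 = 0.
Proof. by rewrite /inv_powers big_geq. Qed.

(** The branch [x |-> b * x - 1] sends [e_(k+1)] to [e_k]: this is what makes the
intervals between consecutive [e_k] a Markov partition. *)
Lemma inv_powers_shift b k : b != 0 ->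
  b * inv_powers b k.+1 = 1 + inv_powers b k.
Proof.
move=> b0; elim: k => [|k IH].
  by rewrite inv_powersS inv_powers0 add0r addr0 expr1 divff.
rewrite inv_powersS mulrDr IH [inv_powers b k.+1]inv_powersS -addrA.
by congr (_ + (_ + _)); rewrite exprS invfM mulrA divff ?mul1r.
Qed.

Lemma sum_expr_inv_powers x n : x != 0 ->
  \sum_(i < n) x ^+ i = x ^+ n * inv_powers x n.
Proof.
move=> x0; elim: n => [|n IH]; first by rewrite big_ord0 inv_powers0 mulr0.
rewrite big_ord_recl inv_powersS mulrDr divff ?expf_neq0// exprS -mulrA.
rewrite addrC expr0; congr (_ + _); rewrite -IH mulr_sumr.
by apply: eq_bigr => i _; rewrite lift0 exprS.
Qed.

Lemma inv_powers_ge0 b k : 0 <= b -> 0 <= inv_powers b k.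
Proof. by move=> b0; apply: sumr_ge0 => i _; rewrite invr_ge0 exprn_ge0. Qed.

Lemma inv_powers_lt b : 0 < b -> {homo inv_powers b : i j / (i < j)%N >-> i < j}.
Proof.
move=> b0; apply: homo_ltn => [? ? ?|i]; first exact: lt_trans.
by rewrite inv_powersS ltrDl invr_gt0 exprn_gt0.
Qed.

Lemma inv_powers_le b : 0 < b ->
  {homo inv_powers b : i j / (i <= j)%N >-> i <= j}.
Proof.
move=> b0 i j; rewrite leq_eqVlt => /predU1P[->//|ij].
by rewrite ltW// inv_powers_lt.
Qed.

Lemma inv_powers_anti n b x : (0 < n)%N -> 0 < b -> b < x ->
  inv_powers x n < inv_powers b n.
Proof.
move=> n0 b0 bx; have x0 := lt_trans b0 bx.
case: n n0 => // n _; rewrite !inv_powersS; apply: ler_ltD.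
  apply: ler_sum => i _.
  by rewrite lef_pV2 ?posrE ?exprn_gt0// lerXn2r ?nnegrE ?ltW.
by rewrite ltf_pV2 ?posrE ?exprn_gt0// ltr_pXn2r ?nnegrE ?ltW.
Qed.

Section Nbonacci.
Context {n : nat} {beta : R} (hn : (2 <= n)%N) (hb : nbonacci_base n beta).

Lemma beta_gt0 : 0 < beta. Proof. by case: hb. Qed.

Let b0 := beta_gt0.

Lemma inv_powers_beta : inv_powers beta n = 1.
Proof.
have := hb.2; rewrite sum_expr_inv_powers ?gt_eqF//.
rewrite -[LHS]mulr1 => /mulfI -> //.
by rewrite gt_eqF// exprn_gt0.
Qed.

Lemma beta_gt1 : 1 < beta.
Proof.
have := inv_powers_shift beta n.-1; rewrite gt_eqF// prednK ?(ltnW hn)//.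
rewrite inv_powers_beta mulr1 => -> //; rewrite ltrDl -(inv_powers0 beta).
by apply: inv_powers_lt => //; case: (n) hn => [|[]].
Qed.

Lemma beta_lt2 : beta < 2.
Proof.
have := inv_powers_shift beta n.-1; rewrite gt_eqF// prednK ?(ltnW hn)//.
rewrite inv_powers_beta mulr1 => -> //; rewrite -[2]/(1 + 1) ltrD2l.
by rewrite -inv_powers_beta inv_powers_lt// prednK// ltnW.
Qed.

(** Dividing by [x ^+ n] turns the hypothesis into a comparison of
[1] with [x^-1 + ... + x^-n], which decreases in [x] and equals [1] at [beta]. *)
Lemma le_beta x : 0 <= x -> x ^+ n <= \sum_(i < n) x ^+ i -> x <= beta.
Proof.
rewrite le0r => /predU1P[-> _|x0]; first exact: ltW.
rewrite sum_expr_inv_powers ?gt_eqF// ler_pMr ?exprn_gt0//.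
apply: contraTT; rewrite -!ltNge -inv_powers_beta => bx.
by apply: inv_powers_anti => //; exact: ltnW.
Qed.
End Nbonacci.
End Base.

(** * Roots of the n-bonacci polynomial *)

Section NormC.
Context {R : rcfType}.
Implicit Types (z w : R[i]) (x : R).

Lemma normc_ge0 z : 0 <= normc z.
Proof. by case: z => a b; exact: sqrtr_ge0. Qed.

Lemma normcX z k : normc (z ^+ k) = normc z ^+ k.
Proof. by elim: k => [|k IH]; rewrite ?normc1// !exprS normcM IH. Qed.

Lemma normc_sum (I : finType) (P : pred I) (F : I -> R[i]) :
  normc (\sum_(i | P i) F i) <= \sum_(i | P i) normc (F i).
Proof.
apply: (big_ind2 (fun z x => normc z <= x)) => //.
  by rewrite normc0.
by move=> z x w y hz hw; apply: le_trans (le_normcD _ _) (lerD hz hw).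
Qed.

Lemma normc_real x : normc (x%:C)%C = `|x|.
Proof. by rewrite /normc /= expr0n/= addr0 sqrtr_sqr. Qed.

Lemma ReD z w : complex.Re (z + w) = complex.Re z + complex.Re w.
Proof. by case: z; case: w. Qed.

Lemma ReM_real z x : complex.Re (z * (x%:C)%C) = complex.Re z * x.
Proof. by case: z => a b /=; rewrite mulr0 subr0. Qed.

Lemma le_Re_normc z : `|complex.Re z| <= normc z.
Proof.
case: z => a b /=; by rewrite -sqrtr_sqr ler_wsqrtr// lerDl sqr_ge0.
Qed.

(** Equality case of the triangle inequality for the segment from [0] to [c]. *)
Lemma normc_segment z (c : R) : 0 <= normc z <= c ->
  normc ((c%:C)%C - z) = c - normc z -> z = ((normc z)%:C)%C.
Proof.
move=> /andP[z0 zc]; case: z z0 zc => a b; set r := normc _ => r0 rc.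
have r2 : r ^+ 2 = a ^+ 2 + b ^+ 2 by rewrite sqr_sqrtr// addr_ge0 ?sqr_ge0.
rewrite /normc /= => /(congr1 (fun x => x ^+ 2)).
rewrite sqr_sqrtr ?addr_ge0 ?sqr_ge0// => h.
have ca : c * a = c * r by lra.
have [c0|c0] := eqVneq c 0.
  have r00 : r = 0 by apply/eqP; rewrite eq_le r0 -c0 rc.
  have : normc (a +i* b)%C = 0 by rewrite -/r.
  by move/eq0_normc=> ->; rewrite r00.
have ar : a = r by apply: (mulfI c0).
have b2 : b ^+ 2 = 0 by rewrite -[LHS](addKr (a ^+ 2)) -r2 ar addNr.
by move/eqP: b2; rewrite sqrf_eq0 => /eqP->; rewrite ar.
Qed.

End NormC.

Section Roots.
Context {R : realType}.
Implicit Types (z : R[i]).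

Lemma root_nbonacciE n z :
  root (nbonacci_poly R n) z = (z ^+ n == \sum_(i < n) z ^+ i).
Proof.
rewrite /root /nbonacci_poly !hornerE horner_sum subr_eq0.
by under eq_bigr do rewrite hornerXn.
Qed.

Lemma nbonacci_poly_mulX n : ('X - 1) * nbonacci_poly R n =
  'X^(n.+1) - 2 * 'X^n + 1 :> {poly R[i]}.
Proof.
rewrite /nbonacci_poly mulrBr -subrX1 mulrBl mul1r exprS; ring.
Qed.

Lemma root_nbonacci_mul n z : root (nbonacci_poly R n) z ->
  z ^+ n * (2 - z) = 1.
Proof.
move=> /rootP h; have := congr1 (fun p => p.[z]) (nbonacci_poly_mulX n).
rewrite hornerM h mulr0 !hornerE => h2; move: (esym h2); rewrite exprS => e.
apply/eqP; rewrite -subr_eq0 -oppr_eq0; apply/eqP; rewrite -e; ring.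
Qed.

Lemma size_nbonacci_poly n : size (nbonacci_poly R n) = n.+1.
Proof.
rewrite /nbonacci_poly size_polyDl ?size_polyXn// size_polyN.
apply: leq_ltn_trans (size_sum _ _ _) _.
by apply/bigmax_leqP => i _; rewrite size_polyXn.
Qed.

Lemma nbonacci_poly_monic n : nbonacci_poly R n \is monic.
Proof.
rewrite monicE lead_coefDl ?lead_coefXn// size_polyN size_polyXn.
apply: leq_ltn_trans (size_sum _ _ _) _.
by apply/bigmax_leqP => i _; rewrite size_polyXn.
Qed.

Lemma root_nbonacci_neq0 n z : (0 < n)%N ->
  root (nbonacci_poly R n) z -> z != 0.
Proof.
case: n => // n _ /root_nbonacci_mul; apply: contra_eq_neq => ->.
by rewrite expr0n mul0r eq_sym oner_eq0.
Qed.

Section Dominant.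
Context {n : nat} {beta : R} (hn : (2 <= n)%N) (hb : nbonacci_base n beta).
Let b0 : 0 < beta := beta_gt0 hb.
Let n0 : (0 < n)%N := ltnW hn.

Lemma root_beta : root (nbonacci_poly R n) (beta%:C)%C.
Proof.
rewrite root_nbonacciE -rmorphXn /= hb.2 rmorph_sum/=.
by apply/eqP/eq_bigr => i _; rewrite rmorphXn.
Qed.

Lemma root_real_pos x : 0 < x -> root (nbonacci_poly R n) (x%:C)%C -> x = beta.
Proof.
move=> x0; rewrite root_nbonacciE => /eqP h.
have hx : nbonacci_base n x.
  split=> //; apply: (@complexI R); rewrite rmorphXn/= h rmorph_sum/=.
  by apply: eq_bigr => i _; rewrite rmorphXn.
apply: le_anti; apply/andP; split.
  by apply: (le_beta hn hb); [exact: ltW|rewrite hx.2].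
by apply: (le_beta hn hx); [exact: ltW|rewrite hb.2].
Qed.

Lemma le_normc_root z : root (nbonacci_poly R n) z -> normc z <= beta.
Proof.
rewrite root_nbonacciE => /eqP h; apply: (le_beta hn hb); first exact: normc_ge0.
rewrite -normcX h; apply: le_trans (normc_sum _ _ _) _.
by apply: ler_sum => i _; rewrite normcX.
Qed.

(** For a root [z], [normc z ^+ n * normc (2 - z) = 1]; if [normc z = beta] this
forces [normc (2 - z) = 2 - normc z], so that [z] lies on the segment from [0]
to [2]. *)
Lemma lt_normc_root z : root (nbonacci_poly R n) z -> z != (beta%:C)%C ->
  normc z < beta.
Proof.
move=> hz zb; rewrite lt_neqAle le_normc_root// andbT.
apply: contraNneq zb => nz.
have /(congr1 (@normc R)) := root_nbonacci_mul _ _ hz.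
have /(congr1 (@normc R)) := root_nbonacci_mul _ _ root_beta.
rewrite !normcM !normcX nz normc_real (ger0_norm (ltW b0)) => <-.
have <- : ((2 : R)%:C)%C = 2 by rewrite rmorph_nat.
rewrite -rmorphB normc_real ger0_norm ?subr_ge0 ?(ltW (beta_lt2 hn hb))//.
move/mulfI => h; apply/eqP; rewrite -nz.
apply: (normc_segment _ 2).
  by rewrite normc_ge0/= nz; exact/ltW/(beta_lt2 hn hb).
by rewrite nz h// expf_neq0// gt_eqF.
Qed.

(** A double root would be a double root of
['X^(n.+1) - 2 * 'X^n + 1], hence equal to [2 n / (n + 1)]; being real and
positive it would be [beta], where the derivative of the polynomial is positive. *)
Lemma nbonacci_simple z : root (nbonacci_poly R n) z ->
  ~~ root (nbonacci_poly R n)^`() z.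
Proof.
move=> hz; apply/negP => hz'.
have z0 := root_nbonacci_neq0 _ _ n0 hz.
have zE : z = ((n.+1%:R^-1 * n.*2%:R)%:C)%C.
  have := congr1 (fun p => p^`().[z]) (nbonacci_poly_mulX n).
  rewrite derivM hornerD !hornerM (rootP hz) (rootP hz') !mulr0 addr0 => h.
  have {h} : z ^+ n.-1 * (z * n.+1%:R - n.*2%:R) = 0.
    rewrite [RHS]h; case: n n0 => // k _ /=.
    rewrite mulr_natl derivD derivB derivMn !derivXn -polyC1 derivC addr0/=.
    rewrite hornerD hornerN !hornerMn !hornerXn -muln2 natrM /=.
    rewrite -(mulr_natr (z ^+ k.+1)) -(mulr_natr (z ^+ k)) exprS.
    rewrite -(mulr_natr (z ^+ k * _) 2).
    ring.
  move/eqP; rewrite mulf_eq0 expf_eq0 (negPf z0) andbF/= subr_eq0 => /eqP e.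
  rewrite rmorphM/= fmorphV/= !rmorph_nat -e mulrC mulfK// pnatr_eq0//.
have zb : z = (beta%:C)%C.
  rewrite zE; congr ((_)%:C)%C; apply: root_real_pos; last by rewrite -zE.
  by rewrite mulr_gt0// ?invr_gt0// ltr0n double_gt0.
have [k nk] : exists k, n = k.+1 by exists n.-1; rewrite prednK.
(* Since [n * beta ^+ n] is [n] times the sum of the lower powers, [beta] times
   the derivative at [beta] is a sum of positive terms. *)
have : (beta%:C)%C * (nbonacci_poly R n)^`().[(beta%:C)%C]
     = ((\sum_(i < n) beta ^+ i * (n - i)%:R)%:C)%C.
  rewrite /nbonacci_poly derivB raddf_sum hornerD hornerN horner_sum mulrBr mulr_sumr.
  rewrite derivXn hornerMn hornerXn.
  have -> : (beta%:C)%C * ((beta%:C)%C ^+ n.-1 *+ n) = ((beta ^+ n * n%:R)%:C)%C.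
    rewrite [LHS]mulrnAr -exprS nk -nk [RHS]rmorphM rmorph_nat rmorphXn /= mulr_natr.
    by rewrite nk.
  have -> : \sum_(i < n) (beta%:C)%C * ('X^i)^`().[(beta%:C)%C]
      = ((\sum_(i < n) beta ^+ i * i%:R)%:C)%C.
    rewrite rmorph_sum; apply: eq_bigr => i _.
    rewrite derivXn hornerMn hornerXn [LHS]mulrnAr -exprS.
    rewrite [RHS]rmorphM rmorph_nat rmorphXn /= mulr_natr.
    by case: (val i) => [|j]; rewrite ?mulr0n.
  rewrite -rmorphB hb.2 mulr_suml -sumrB; congr ((_)%:C)%C.
  by apply: eq_bigr => i _; rewrite natrB 1?ltnW// mulrBr.
rewrite -zb (rootP hz') mulr0 => /esym/(@complexI R _ 0)/eqP.
apply/negP; rewrite gt_eqF// nk big_ord_recl subn0 expr0 mul1r.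
rewrite ltr_pwDl ?ltr0n// sumr_ge0// => i _.
by rewrite mulr_ge0// exprn_ge0// ltW.
Qed.

Lemma nbonacci_roots : exists s : n.-tuple R[i],
  nbonacci_poly R n = \prod_(z <- s) ('X - z%:P) /\ uniq s.
Proof.
have [s hs] := closed_field_poly_normal (nbonacci_poly R n).
rewrite (monicP (nbonacci_poly_monic n)) scale1r in hs.
have sz : size s == n.
  by rewrite -eqSS -(size_nbonacci_poly n) hs size_prod_XsubC.
exists (Tuple sz); split => //.
rewrite -separable_prod_XsubC -hs unlock.
rewrite /coprimep; apply/negPn/negP => /closed_rootP[z].
by rewrite root_gcd => /andP[/nbonacci_simple/negP].
Qed.

(** If [z] comes first in the list of the roots, then its modulus is at most
[beta], and [beta] itself comes later in the list. *)
Lemma second_largest_ge (l : R[i]) z : second_largest_root n l ->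
  root (nbonacci_poly R n) z -> z != (beta%:C)%C -> normc z <= normc l.
Proof.
move=> [s [hs ss ->]] hz zb; have hbr := root_beta.
rewrite hs root_prod_XsubC in hz; rewrite hs root_prod_XsubC in hbr.
have tr : transitive (fun z w : R[i] => normc w <= normc z).
  by move=> a b c ab ca; exact: le_trans ca ab.
have key y : y \in s -> y != s`_0 -> normc y <= normc s`_1.
  move=> ys y0; rewrite -(nth_index 0 ys).
  have i1 : (1 <= index y s)%N.
    by rewrite lt0n; apply: contraNneq y0 => {1}<-; rewrite nth_index.
  move: i1; rewrite leq_eqVlt => /predU1P[<-//|i1].
  apply: (sorted_ltn_nth tr 0 ss) => //; rewrite inE ?index_mem//.
  by apply: leq_trans i1 _; rewrite ltnW// index_mem.
have [z0|z0] := eqVneq z s`_0; last exact: key.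
have zroot : root (nbonacci_poly R n) z by rewrite hs root_prod_XsubC.
apply: (le_trans (le_normc_root _ zroot)).
rewrite -(ger0_norm (ltW b0)) -normc_real key//.
by rewrite -z0 eq_sym.
Qed.

(** The roots [z_j] being simple, the Vandermonde matrix is invertible, so a
solution of the recurrence is a combination of the [z_j ^+ k] whose coefficients
are controlled by the first [n] terms. The rate [rho] is the largest modulus of
the roots other than [beta]; it does not refer to any ordering of the roots, and
it is positive because [0] is not a root. *)
Lemma nbonacci_spectral : exists rho K : R,
  [/\ 0 < rho < beta, 0 <= K,
      forall l, second_largest_root n l -> rho <= normc l &
      forall w : nat -> R, (forall k, w (k + n)%N = \sum_(i < n) w (k + i)%N) ->
        exists A, forall k,
          `|w k - A * beta ^+ k| <= K * (\sum_(i < n) `|w i|) * rho ^+ k].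
Proof.
have [s [hs us]] := nbonacci_roots.
have rs j : root (nbonacci_poly R n) (tnth s j).
  by rewrite hs root_prod_XsubC mem_tnth.
have /tnthP[j0 hj0] : (beta%:C)%C \in s by rewrite -root_prod_XsubC -hs root_beta.
have neq_root j : j != j0 -> tnth s j != (beta%:C)%C.
  by apply: contra => /eqP; rewrite hj0 => /(tuple_uniqP _ us) ->.
have [j1 hj1] : exists j, j != j0.
  have [m mn] : exists m, n = m.+2 by exists n.-2; case: (n) hn => [|[]].
  clear -mn; subst n; case: (eqVneq j0 ord0) => [->|h]; first by exists ord_max.
  by exists ord0; rewrite eq_sym.
pose V := Vandermonde n (\row_j tnth s j).
have uV : V \in unitmx.
  rewrite unitmxE det_Vandermonde unitfE.
  apply/prodf_neq0 => i _; apply/prodf_neq0 => j ij; rewrite !mxE subr_eq0.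
  by apply: contraTneq ij => /(tuple_uniqP _ us) ->; rewrite ltnn.
case: (@arg_maxP _ R _ j1 (fun j => j != j0) (fun j => normc (tnth s j)) hj1) => jm hjm hmax.
set rho := normc (tnth s jm).
pose K0 : R := \sum_j \sum_i normc (invmx V j i).
have K00 : 0 <= K0 by do 2 (apply: sumr_ge0 => ? _); exact: normc_ge0.
exists rho, (n%:R * K0); split.
- apply/andP; split; last by apply: lt_normc_root => //; exact: neq_root.
  rewrite lt_neqAle normc_ge0 andbT eq_sym.
  by apply: contra (root_nbonacci_neq0 _ _ n0 (rs jm)) => /eqP/eq0_normc ->.
- by rewrite mulr_ge0.
- by move=> l hl; apply: second_largest_ge => //; exact: neq_root.
move=> w hw; pose S := \sum_(i < n) `|w i|.
pose c := invmx V *m (\col_i ((w (val i))%:C)%C).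
have cE k : ((w k)%:C)%C = \sum_j c j 0 * tnth s j ^+ k.
  elim/ltn_ind: k => k IH; have [kn|nk] := ltnP k n.
    have : V *m c = \col_i ((w (val i))%:C)%C by rewrite mulKVmx.
    move/matrixP/(_ (Ordinal kn) 0); rewrite !mxE => <-.
    by apply: eq_bigr => j _; rewrite !mxE mulrC.
  rewrite -(subnK nk) hw rmorph_sum /=.
  under eq_bigr => i _.
    rewrite IH; last by rewrite -{2}(subnK nk) ltn_add2l.
    over.
  rewrite exchange_big; apply: eq_bigr => j _ /=; rewrite -mulr_sumr exprD.
  have := rs j; rewrite root_nbonacciE => /eqP ->.
  by congr (_ * _); rewrite mulr_sumr; under eq_bigr do rewrite exprD.
have cle j : normc (c j 0) <= K0 * S.
  rewrite mxE; apply: le_trans (normc_sum _ _ _) _.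
  apply: (@le_trans _ _ (\sum_i normc (invmx V j i) * S)).
    apply: ler_sum => i _; rewrite !mxE normcM normc_real.
    rewrite ler_wpM2l ?normc_ge0// /S (bigD1 i)//= lerDl.
    by apply: sumr_ge0.
  rewrite -mulr_suml; apply: ler_wpM2r; first exact: sumr_ge0.
  rewrite /K0 [leRHS](bigD1 j)//= lerDl.
  by do 2 (apply: sumr_ge0 => ? _); exact: normc_ge0.
(* The coefficient of [beta ^+ k] is complex a priori; its real part will do,
   because the sequence is real. *)
exists (complex.Re (c j0 0)) => k.
have -> : w k - complex.Re (c j0 0) * beta ^+ k =
    complex.Re (\sum_(j | j != j0) c j 0 * tnth s j ^+ k).
  have := congr1 (@complex.Re R) (cE k); rewrite (bigD1 j0)//= ReD => ->.
  by rewrite -hj0 -rmorphXn /= ReM_real addrC addKr.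
apply: le_trans (le_Re_normc _) _; apply: le_trans (normc_sum _ _ _) _.
apply: (@le_trans _ _ (\sum_(j | j != j0) K0 * S * rho ^+ k)).
  apply: ler_sum => j jj0; rewrite normcM normcX ler_pM ?normc_ge0 ?exprn_ge0//.
    exact: normc_ge0.
  by rewrite lerXn2r ?nnegrE ?normc_ge0//; exact: hmax.
rewrite big_const iter_addr addr0 -[leLHS]mulr_natl -!mulrA.
apply: ler_wpM2r.
  by apply: mulr_ge0 => //; apply: mulr_ge0; rewrite ?exprn_ge0 ?normc_ge0 //; exact: sumr_ge0.
by rewrite ler_nat -[X in (_ <= X)%N]card_ord max_card.
Qed.
End Dominant.
End Roots.

(** * The transfer operator on step functions *)

Section Transfer.
Context {R : realType}.
Implicit Types (b x y : R) (h g : R -> R) (v : nat -> R).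

(** The second branch should only contribute for [x < b - 1]; on functions that
vanish off [0, 1), as all densities here do, this restriction is automatic,
because [(1 + x) / b < 1] exactly when [x < b - 1]. *)
Definition transfer b h x : R :=
  \1_[set` `[(0:R), 1[] x * (b^-1 * (h (x / b) + h ((1 + x) / b))).

Definition step n b v x : R :=
  \sum_(j < n) v j * \1_[set` `[inv_powers b j, inv_powers b j.+1[] x.

(** The matrix of [b * transfer b] in the basis of the indicators of the
pieces [[e_j, e_(j+1))]. *)
Definition companion n v j : R := if (j < n)%N then v 0%N + v j.+1 else 0.

Definition supported h := forall x, ~~ (0 <= x < 1) -> h x = 0.

Lemma indic_itv (a c x : R) : \1_[set` `[a, c[] x = (a <= x < c)%R%:R :> R.
Proof. by rewrite indicE mem_setE in_itv. Qed.

Lemma transfer_in b h x : 0 <= x < 1 ->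
  transfer b h x = b^-1 * (h (x / b) + h ((1 + x) / b)).
Proof. by move=> x01; rewrite /transfer indic_itv x01 mul1r. Qed.

Lemma transfer_supported b h : supported (transfer b h).
Proof. by move=> x /negPf x01; rewrite /transfer indic_itv x01 mul0r. Qed.

Lemma iter_transfer_supported b h k : supported h ->
  supported (iter k (transfer b) h).
Proof. by case: k => // k _; exact: transfer_supported. Qed.

Lemma transferD b h g :
  transfer b (fun x => h x + g x) = (fun x => transfer b h x + transfer b g x).
Proof. by apply/funext => x; rewrite /transfer; ring. Qed.

Lemma transferZ b (c : R) h :
  transfer b (fun x => c * h x) = (fun x => c * transfer b h x).
Proof. by apply/funext => x; rewrite /transfer; ring. Qed.

Lemma le_transfer b h g : 0 < b -> (forall x, h x <= g x) ->
  forall x, transfer b h x <= transfer b g x.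
Proof.
move=> b0 hg x; rewrite /transfer indic_itv.
apply: ler_wpM2l; first exact: ler0n.
by apply: ler_wpM2l; [rewrite invr_ge0 ltW | exact: lerD].
Qed.

Lemma iter_transferD b h g k : iter k (transfer b) (fun x => h x + g x) =
  (fun x => iter k (transfer b) h x + iter k (transfer b) g x).
Proof. by elim: k => //= k ->; rewrite transferD. Qed.

Lemma iter_transferZ b (c : R) h k : iter k (transfer b) (fun x => c * h x) =
  (fun x => c * iter k (transfer b) h x).
Proof. by elim: k => //= k ->; rewrite transferZ. Qed.

Lemma le_iter_transfer b h g k : 0 < b -> (forall x, h x <= g x) ->
  forall x, iter k (transfer b) h x <= iter k (transfer b) g x.
Proof. by move=> b0 hg; elim: k => //= k IH; exact: le_transfer. Qed.

Lemma iter_transfer_ge0 b h k : 0 < b -> (forall x, 0 <= h x) ->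
  forall x, 0 <= iter k (transfer b) h x.
Proof.
move=> b0 h0; elim: k => //= k IH x.
by rewrite /transfer indic_itv mulr_ge0// mulr_ge0 ?invr_ge0 ?addr_ge0// ltW.
Qed.

Lemma eq_step n b v v' : (forall j, (j < n)%N -> v j = v' j) ->
  step n b v = step n b v'.
Proof. by move=> e; apply/funext => x; apply: eq_bigr => j _; rewrite e. Qed.

Lemma companionZ n (c : R) v :
  companion n (fun j => c * v j) = (fun j => c * companion n v j).
Proof.
by apply/funext => j; rewrite /companion; case: ifP; rewrite ?mulr0 ?mulrDr.
Qed.

Lemma iter_companion_n n v k : v n = 0 -> iter k (companion n) v n = 0.
Proof. by case: k => //= k; rewrite /companion ltnn. Qed.

(** The companion shift pushes an entry out of the vector in at most [n] steps,
so that its orbit is determined by the entries of index [0]. For [i = n] this is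
the n-bonacci recurrence for those entries. *)
Lemma iter_companionE n v k i : v n = 0 -> (i <= n)%N -> (i <= k)%N ->
  iter k (companion n) v (n - i)%N
  = \sum_(l < i) iter (k - l.+1)%N (companion n) v 0%N.
Proof.
move=> vn; elim: i k => [|i IH] k i_n ik.
  by rewrite subn0 big_ord0 iter_companion_n.
case: k ik => // k ik; rewrite big_ord_recl /= subSS subn0.
rewrite {1}/companion ltn_subrL /= (leq_trans _ i_n)// -subSn// subSS IH//.
exact: ltnW.
Qed.

Lemma iter_companion_bound n v (B : R) k j : (forall j, 0 <= v j <= B) ->
  0 <= iter k (companion n) v j <= 2 ^+ k * B.
Proof.
move=> vB; elim: k j => [|k IH] j; first by rewrite mul1r.
rewrite iterS /companion; case: ifP => _.
  have /andP[a1 a2] := IH 0%N; have /andP[c1 c2] := IH j.+1.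
  by rewrite addr_ge0//= exprS -mulrA mulrDl mul1r lerD.
rewrite lexx/= mulr_ge0 ?exprn_ge0//.
by have /andP[] := vB 0%N; exact: le_trans.
Qed.

Section Nbonacci.
Context {n : nat} {b : R} (hn : (2 <= n)%N) (hb : nbonacci_base n b).
Let b0 : 0 < b := beta_gt0 hb.
Let n0 : (0 < n)%N := ltnW hn.
Let b_neq0 : b != 0. Proof. by rewrite gt_eqF. Qed.
Local Notation e := (inv_powers b).

Lemma inv_powers_leE i j : (e i <= e j) = (i <= j)%N.
Proof.
apply/idP/idP; last exact: inv_powers_le.
by apply: contraTT; rewrite -ltNge -ltnNge; exact: inv_powers_lt.
Qed.

Lemma piece_exists x : 0 <= x < 1 -> exists2 j, (j < n)%N & e j <= x < e j.+1.
Proof.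
move=> /andP[x0 x1].
have H : exists i, x < e i.+1 by exists n.-1; rewrite prednK// inv_powers_beta.
case: (ex_minnP H) => j xj jmin; exists j.
  by rewrite -(prednK n0) ltnS jmin// prednK// inv_powers_beta.
rewrite xj andbT; case: j xj jmin => [|j] xj jmin; first by rewrite inv_powers0.
by rewrite leNgt; apply/negP => /jmin; rewrite ltnn.
Qed.

Lemma piece01 j x : (j < n)%N -> e j <= x < e j.+1 -> 0 <= x < 1.
Proof.
move=> jn /andP[jx xj].
rewrite (le_trans _ jx) ?inv_powers_ge0 ?ltW//= (lt_le_trans xj)//.
by rewrite -(inv_powers_beta hb) inv_powers_leE.
Qed.

Lemma step_in v j x : (j < n)%N -> e j <= x < e j.+1 -> step n b v x = v j.
Proof.
move=> jn /andP[jx xj]; rewrite /step (bigD1 (Ordinal jn))//= indic_itv jx xj.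
rewrite mulr1 big1 ?addr0// => i ij; rewrite indic_itv.
case: andP => [[ix xi]|]; last by rewrite mulr0.
case/eqP: ij; apply: val_inj; apply/eqP; rewrite eqn_leq /=.
apply/andP; split; rewrite -ltnS ltnNge -inv_powers_leE -ltNge.
  exact: le_lt_trans ix xj.
exact: le_lt_trans jx xi.
Qed.

Lemma step_supported v : supported (step n b v).
Proof.
move=> x x01; apply: big1 => j _; rewrite indic_itv.
case: (boolP (_ <= _ < _)) => [h|]; last by rewrite mulr0.
by rewrite (piece01 _ _ (ltn_ord j) h) in x01.
Qed.

Lemma piece_div x : 0 <= x < 1 -> e 0 <= x / b < e 1.
Proof.
move=> /andP[x0 x1]; rewrite inv_powersS inv_powers0 add0r expr1.
apply/andP; split; first by apply: divr_ge0 => //; exact: ltW.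
by rewrite ltr_pdivrMr// mulVf.
Qed.

Lemma piece_shift j x : e j <= x < e j.+1 ->
  e j.+1 <= (1 + x) / b < e j.+2.
Proof.
move=> /andP[jx xj].
by rewrite ler_pdivlMr// ltr_pdivrMr// ![_ * b]mulrC !inv_powers_shift// lerD2l ltrD2l jx.
Qed.

Lemma shift_out x : e n.-1 <= x -> ~~ (0 <= (1 + x) / b < 1).
Proof.
move=> nx; rewrite negb_and -leNgt; apply/orP; right.
have : b * e n.-1.+1 = b by rewrite prednK// inv_powers_beta// mulr1.
by rewrite inv_powers_shift// ler_pdivlMr// mul1r => <-; rewrite lerD2l.
Qed.

(** On the piece of index [j], [x / b] lies in the first piece and [(1 + x) / b]
in the piece of index [j + 1], or outside [0, 1) when [j] is the last index. *)
Lemma transfer_step v : v n = 0 ->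
  transfer b (step n b v) = step n b (fun j => b^-1 * companion n v j).
Proof.
move=> vn; apply/funext => x.
have [x01|x01] := boolP (0 <= x < 1); last first.
  by rewrite transfer_supported// step_supported.
have [j jn xj] := piece_exists _ x01.
rewrite transfer_in// [RHS](step_in _ j)// /companion jn; congr (_ * (_ + _)).
  by rewrite (step_in _ 0%N)// piece_div.
move: jn; rewrite leq_eqVlt => /predU1P[jn|jn].
  rewrite step_supported ?jn ?vn//; apply: shift_out; rewrite -jn /=.
  by case/andP: xj.
by rewrite (step_in _ j.+1)// piece_shift.
Qed.

Lemma iter_transfer_step v k : v n = 0 ->
  iter k (transfer b) (step n b v)
  = step n b (fun j => b ^- k * iter k (companion n) v j).
Proof.
move=> vn; elim: k => [|k IH] /=.
  by apply: eq_step => j _; rewrite invr1 mul1r.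
rewrite IH transfer_step ?iter_companion_n ?mulr0//.
by apply: eq_step => j _; rewrite companionZ exprS invfM mulrA.
Qed.


(** ** The Parry density as a step function *)

Definition parry_sum x : R := \sum_(1 <= j < n.+1) parry_step b j x.

(** Writing the coefficients as sums of inverse powers makes the Parry step
function visibly proportional to the limit of the companion orbits, whose entry
of index [j] is a sum of [n - j] consecutive terms. *)
Lemma parry_coefE j : (j < n)%N ->
  b ^+ j.+1 - \sum_(1 <= i < j.+1) b ^+ i = b * e (n - j)%N.
Proof.
elim: j => [|j IH] jn.
  by rewrite subn0 inv_powers_beta// big_geq// subr0 mulr1.
have /(congr1 ( *%R b)) := IH (ltnW jn).
rewrite -(subnSK (ltnW jn)) inv_powers_shift// => h.
have -> : \sum_(1 <= i < j.+2) b ^+ i = b * (1 + \sum_(1 <= i < j.+1) b ^+ i).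
  rewrite big_add1 /=; under eq_bigr do rewrite exprS.
  by rewrite -mulr_sumr [in LHS]big_ltn// expr0.
by rewrite [b ^+ j.+2]exprS; lra.
Qed.

Lemma parry_sumE : parry_sum = step n b (fun j => b * e (n - j)%N).
Proof.
apply/funext => x; rewrite /parry_sum big_add1 big_mkord /=.
apply: eq_bigr => j _; rewrite -parry_coefE//.
Qed.

Lemma companion_parry :
  companion n (fun j => b * e (n - j)%N) = (fun j => b * (b * e (n - j)%N)).
Proof.
apply/funext => j; rewrite /companion; case: ltnP => jn; last first.
  by move: jn; rewrite -subn_eq0 => /eqP ->; rewrite inv_powers0 !mulr0.
by rewrite subn0 inv_powers_beta// -[in RHS](subnSK jn) inv_powers_shift// mulrDr.
Qed.

Lemma transfer_parry : transfer b parry_sum = parry_sum.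
Proof.
rewrite parry_sumE transfer_step ?subnn ?inv_powers0 ?mulr0//.
by apply: eq_step => j _; rewrite companion_parry mulKf.
Qed.

Lemma iter_transfer_parry k : iter k (transfer b) parry_sum = parry_sum.
Proof. by elim: k => //= k ->; exact: transfer_parry. Qed.

Lemma parry_sum_bounds x : 0 <= x < 1 -> 1 <= parry_sum x <= b.
Proof.
move=> x01; have [j jn xj] := piece_exists _ x01.
rewrite parry_sumE (step_in _ j)//; apply/andP; split.
  have -> : 1 = b * e 1 :> R by rewrite inv_powers_shift// inv_powers0 addr0.
  by rewrite ler_pM2l// inv_powers_leE subn_gt0.
by rewrite -[leRHS]mulr1 -(inv_powers_beta hb) ler_pM2l// inv_powers_leE leq_subr.
Qed.

Lemma parry_sum_supported : supported parry_sum.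
Proof. by rewrite parry_sumE; exact: step_supported. Qed.

Lemma parry_sum_ge0 x : 0 <= parry_sum x.
Proof.
have [x01|x01] := boolP (0 <= x < 1); last by rewrite parry_sum_supported.
by have /andP[h _] := parry_sum_bounds _ x01; exact: le_trans h.
Qed.

Definition one01 x : R := \1_[set` `[(0:R), 1[] x.

Lemma one01E x : one01 x = (0 <= x < 1)%R%:R.
Proof. exact: indic_itv. Qed.

(** The indicator of [0, 1) lies below the fixed point [parry_sum]. *)
Lemma iter_transfer_one_le k x : iter k (transfer b) one01 x <= b.
Proof.
apply: (@le_trans _ _ (parry_sum x)); last first.
  have [x01|x01] := boolP (0 <= x < 1); first by have /andP[] := parry_sum_bounds _ x01.
  by rewrite parry_sum_supported// ltW.
rewrite -(iter_transfer_parry k); apply: le_iter_transfer => // y.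
rewrite one01E; have [y01|y01] := boolP (0 <= y < 1); last exact: parry_sum_ge0.
by have /andP[] := parry_sum_bounds _ y01.
Qed.

(** ** Convergence on step functions *)

(** The entries of the orbit are sums of consecutive terms of an n-bonacci
sequence, and replacing each term by its equivalent [A * b ^+ k] produces the
values of [parry_sum]. *)
Lemma step_spectral (rho K : R) : 0 < rho -> 0 <= K ->
  (forall w : nat -> R, (forall k, w (k + n)%N = \sum_(i < n) w (k + i)%N) ->
     exists A, forall k,
       `|w k - A * b ^+ k| <= K * (\sum_(i < n) `|w i|) * rho ^+ k) ->
  exists2 K1 : R, 0 <= K1 & forall v (B : R), v n = 0 ->
    (forall j, 0 <= v j <= B) ->
    exists2 A : R, 0 <= A & forall k x, (n <= k)%N -> 0 <= x < 1 ->
      `|iter k (transfer b) (step n b v) x - A * parry_sum x|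
      <= K1 * B * (rho / b) ^+ k.
Proof.
move=> rho0 K0 spec.
pose Q : R := \sum_(l < n) rho ^- l.+1.
have Q0 : 0 <= Q by apply: sumr_ge0 => l _; rewrite invr_ge0 exprn_ge0// ltW.
exists (K * (n%:R * 2 ^+ n) * Q); first by rewrite !mulr_ge0 ?exprn_ge0.
move=> v B vn vB; pose w k := iter k (companion n) v 0%N.
have B0 : 0 <= B by have /andP[] := vB 0%N; exact: le_trans.
have [|A hA] := spec w.
  move=> k; rewrite /w -{1}(subnn n) iter_companionE// ?leq_addl//.
  rewrite (reindex_inj rev_ord_inj) /=; apply: eq_bigr => i _.
  by congr (iter _ _ _ _); have := ltn_ord i; lia.
have wS : \sum_(i < n) `|w i| <= n%:R * 2 ^+ n * B.
  apply: (@le_trans _ _ (\sum_(i < n) 2 ^+ n * B)).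
    apply: ler_sum => i _; rewrite /w.
    have /andP[w0 wB] := iter_companion_bound n v B i 0%N vB.
    rewrite ger0_norm//; apply: le_trans wB _; rewrite ler_wpM2r//.
    by rewrite ler_weXn2l ?ler1n// ltnW.
  by rewrite sumr_const card_ord -[leLHS]mulr_natl mulrA.
(* A negative coefficient can be replaced by [0], because the iterates are
   nonnegative; this keeps all later integrands nonnegative. *)
exists (Num.max (A / b) 0); first by rewrite le_max lexx orbT.
move=> k x nk x01; have [j jn xj] := piece_exists _ x01.
have T0 : 0 <= iter k (transfer b) (step n b v) x.
  apply: iter_transfer_ge0 => // z; apply: sumr_ge0 => i _.
  by rewrite indic_itv mulr_ge0//; have /andP[] := vB i.
apply: (@le_trans _ _ `|iter k (transfer b) (step n b v) x - A / b * parry_sum x|).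
  have [h|h] := leP 0 (A / b); first by [].
  rewrite mul0r subr0 ger0_norm// ler_normr; apply/orP; left.
  by rewrite lerDl oppr_ge0 mulr_le0_ge0 ?parry_sum_ge0// ltW.
rewrite iter_transfer_step// parry_sumE !(step_in _ j)//.
have powB (z : R) l : (l < k)%N -> z != 0 -> z ^+ (k - l.+1)%N = z ^+ k * z ^- l.+1.
  by move=> lk z0; rewrite -{2}(subnK lk) exprD mulfK// expf_neq0.
have lk (l : 'I_(n - j)) : (l < k)%N.
  by apply: leq_trans (ltn_ord l) _; apply: leq_trans (leq_subr _ _) nk.
have eE m : e m = \sum_(l < m) b ^- l.+1 by rewrite /inv_powers big_add1 big_mkord.
have -> : b ^- k * iter k (companion n) v j - A / b * (b * e (n - j)%N)
    = b ^- k * \sum_(l < n - j) (w (k - l.+1)%N - A * b ^+ (k - l.+1)%N).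
  rewrite -{1}(subKn (ltnW jn)) iter_companionE ?leq_subr//; last first.
    exact: leq_trans (leq_subr _ _) nk.
  rewrite sumrB mulrBr; congr (_ - _).
  rewrite mulrA divfK// eE -mulr_sumr mulrCA; congr (A * _).
  by rewrite mulr_sumr; apply: eq_bigr => l _; rewrite powB// mulKf// expf_neq0.
rewrite normrM ger0_norm ?invr_ge0 ?exprn_ge0 ?(ltW b0)//.
rewrite expr_div_n [leRHS]mulrA [leRHS]mulrC ler_pM2l ?invr_gt0 ?exprn_gt0//.
apply: le_trans (ler_norm_sum _ _ _) _.
apply: (@le_trans _ _ (\sum_(l < n - j) K * (n%:R * 2 ^+ n * B) * (rho ^+ k * rho ^- l.+1))).
  apply: ler_sum => l _; apply: le_trans (hA _) _.
  rewrite powB ?gt_eqF// ler_wpM2r ?ler_wpM2l//.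
  by rewrite mulr_ge0 ?invr_ge0 ?exprn_ge0 ?(ltW rho0).
have -> : K * (n%:R * 2 ^+ n) * Q * B * rho ^+ k =
   K * (n%:R * 2 ^+ n * B) * (rho ^+ k * Q) by ring.
rewrite -!mulr_sumr ler_wpM2l ?mulr_ge0 ?exprn_ge0// ler_wpM2l ?exprn_ge0 ?(ltW rho0)//.
rewrite /Q (big_ord_widen n (fun l => rho ^- l.+1)) ?leq_subr//.
rewrite [leRHS](bigID (fun l : 'I_n => (l < n - j)%N)) /= lerDl.
by apply: sumr_ge0 => l _; rewrite invr_ge0 exprn_ge0// ltW.
Qed.

(** ** Oscillation on pieces *)

(** Both inverse branches contract distances by [b] and send a piece into a
piece, or outside [0, 1), so that corresponding terms of [T^m h (x)] and
[T^m h (y)] evaluate [h] at points within [d * b ^- m] of each other;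
[T^m 1 (x)] is the number of terms divided by [b ^+ m]. *)
Lemma iter_transfer_osc h m (d delta : R) j x y : supported h ->
  (forall x y, 0 <= x < 1 -> 0 <= y < 1 -> `|x - y| <= d * b ^- m ->
     `|h x - h y| <= delta) ->
  (j < n)%N -> e j <= x < e j.+1 -> e j <= y < e j.+1 -> `|x - y| <= d ->
  `|iter m (transfer b) h x - iter m (transfer b) h y|
  <= delta * iter m (transfer b) one01 x.
Proof.
move=> hs; elim: m d j x y => [|m IH] d j x y hd jn xj yj xyd.
  have x01 := piece01 _ _ jn xj; have y01 := piece01 _ _ jn yj.
  by rewrite /= one01E x01 mulr1 hd// expr0 invr1 mulr1.
have x01 := piece01 _ _ jn xj; have y01 := piece01 _ _ jn yj.
rewrite !iterS !transfer_in// -mulrBr normrM gtr0_norm ?invr_gt0//.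
rewrite mulrCA ler_pM2l ?invr_gt0// mulrDr opprD addrACA.
have hd' u z : 0 <= u < 1 -> 0 <= z < 1 -> `|u - z| <= d / b * b ^- m ->
   `|h u - h z| <= delta.
  by move=> u01 z01 uz; apply: hd => //; rewrite exprS invfM mulrA.
have xydb : `|x - y| / b <= d / b by rewrite ler_pM2r ?invr_gt0.
apply: le_trans (ler_normD _ _) (lerD _ _).
  apply: (IH _ 0%N _ _ hd') => //; [exact: piece_div|exact: piece_div|].
  by rewrite -mulrBl normrM (gtr0_norm (_ : 0 < b^-1)) ?invr_gt0.
move: jn; rewrite leq_eqVlt => /predU1P[jn|jn].
  have out z : e j <= z < e j.+1 -> ~~ (0 <= (1 + z) / b < 1).
    by move=> /andP[jz _]; apply: shift_out; rewrite -jn.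
  rewrite !iter_transfer_supported ?out// => [|z /negPf]; last by rewrite one01E => ->.
  by rewrite subrr normr0 mulr0.
apply: (IH _ j.+1 _ _ hd') => //; [exact: piece_shift|exact: piece_shift|].
by rewrite -mulrBl opprD addrACA subrr add0r normrM (gtr0_norm (_ : 0 < b^-1)) ?invr_gt0.
Qed.

(** The value [0] from index [n] on is the boundary condition of
[transfer_step]. *)
Definition sample h j : R := if (j < n)%N then h (e j) else 0.

Lemma iter_transfer_sample h m (delta : R) x : supported h -> 0 <= delta ->
  (forall x y, 0 <= x < 1 -> 0 <= y < 1 -> `|x - y| <= b ^- m ->
     `|h x - h y| <= delta) -> 0 <= x < 1 ->
  `|iter m (transfer b) h x - step n b (sample (iter m (transfer b) h)) x|
  <= delta * b.
Proof.
move=> hs d0 hd x01; have [j jn xj] := piece_exists _ x01.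
rewrite (step_in _ j)// /sample jn.
have ej : e j <= e j < e j.+1 by rewrite lexx inv_powers_lt.
apply: le_trans (_ : _ <= delta * iter m (transfer b) one01 x) _.
  apply: (iter_transfer_osc _ _ 1 _ j) => //.
    by move=> *; apply: hd; rewrite // -[leRHS]mul1r.
  have := piece01 _ _ jn ej; move: x01 => /andP[x0 x1] /andP[e0 e1].
  by rewrite ler_norml; apply/andP; split; lra.
by rewrite ler_wpM2l// iter_transfer_one_le.
Qed.

End Nbonacci.
End Transfer.

(** * The formula for the densities *)

Section Words.
Context {R : realType} {n : nat} {b : R}.
Hypotheses (hn : (2 <= n)%N) (hb : nbonacci_base n b).
Let b0 : 0 < b := beta_gt0 hb.
Let n0 : (0 < n)%N := ltnW hn.
Local Notation e := (inv_powers b).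

Lemma prefix_nseq_true k (s : seq bool) :
  prefix (nseq k true) s = (k <= find negb s)%N.
Proof. by elim: k s => [|k IH] [|[] s] //=; rewrite IH. Qed.

Lemma infix_nseq_rcons k (s : seq bool) c :
  infix (nseq k true) (rcons s c) =
  (k <= find negb (c :: rev s))%N || infix (nseq k true) s.
Proof.
rewrite -infix_rev rev_rcons rev_nseq infix_consl prefix_nseq_true.
by rewrite -[in RHS]infix_rev rev_nseq.
Qed.

Lemma words_rcons_false m (J : m.-tuple bool) :
  (rcons_tuple J false \in words n m.+1) = (J \in words n m).
Proof. by rewrite !inE /= infix_nseq_rcons /= leqNgt n0. Qed.

Lemma words_rcons_true m (J : m.-tuple bool) :
  (rcons_tuple J true \in words n m.+1)
  = (J \in words n m) && (trailing_ones J < n.-1)%N.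
Proof.
rewrite !inE /= infix_nseq_rcons /= negb_or andbC -ltnNge; congr (_ && _).
by rewrite -[in LHS](prednK n0) ltnS.
Qed.

Lemma trailing_ones_lt m (J : m.-tuple bool) : J \in words n m ->
  (trailing_ones J < n)%N.
Proof.
rewrite inE ltnNge; apply: contra; rewrite -prefix_nseq_true => h.
by rewrite -infix_rev rev_nseq; exact: prefixW.
Qed.

Lemma trailing_ones_rcons m (J : m.-tuple bool) c :
  trailing_ones (rcons_tuple J c) = if c then (trailing_ones J).+1 else 0%N.
Proof. by rewrite /trailing_ones /= rev_rcons; case: c. Qed.

Lemma word_value_rcons m (J : m.-tuple bool) c :
  word_value b (rcons_tuple J c) = word_value b J + c%:R * b ^- m.+1.
Proof.
rewrite /word_value big_ord_recr /=; congr (_ + _); last first.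
  by rewrite (tnth_nth false) /= nth_rcons size_tuple ltnn eqxx.
apply: eq_bigr => i _.
by rewrite !(tnth_nth false) /= nth_rcons size_tuple ltn_ord.
Qed.

Lemma rcons_tuple_bij m :
  bijective (fun p : m.-tuple bool * bool => rcons_tuple p.1 p.2).
Proof.
apply: inj_card_bij => [[J c] [J' c']|].
  move/(congr1 val)/rcons_inj => /= [JJ ->]; congr (_, _); exact: val_inj.
by rewrite card_prod !card_tuple card_bool expnS mulnC.
Qed.

Lemma sum_rcons m (F : m.+1.-tuple bool -> R) :
  \sum_J F J = \sum_J (F (rcons_tuple J true) + F (rcons_tuple J false)).
Proof.
rewrite (reindex _ (onW_bij _ (rcons_tuple_bij m))) /=.
rewrite -(pair_bigA _ (fun J c => F (rcons_tuple J c))) /=.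
by apply: eq_bigr => J _; rewrite big_bool.
Qed.

(** Appending a last digit to the words amounts to applying the transfer
operator: a final [0] can always be added, and when a final [1] is added to [J]
the indicator of [x < K (J 1)] is the one of [(1 + x) / b < K J]. *)
Lemma remainder_densityE (f : R -> R) m : supported f ->
  remainder_density n b f m = iter m (transfer b) f.
Proof.
move=> fs; elim: m => [|m IH]; apply/funext => x.
  rewrite /remainder_density /= (big_pred1 [tuple]); last first.
    move=> J; rewrite [J]tuple0; transitivity true; last exact/esym/eqP.
    by rewrite inE infixs0 -size_eq0 size_nseq -lt0n.
  rewrite /trailing_ones /= subn0 inv_powers_beta// indic_itv /word_value big_ord0.
  rewrite expr0 invr1 !mul1r add0r.
  by have [x01|/fs ->] := boolP (0 <= x < 1); rewrite ?mul1r ?mulr0.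
have [x01|x01] := boolP (0 <= x < 1); last first.
  rewrite iterS transfer_supported// /remainder_density big1 ?mulr0// => J _.
  rewrite indic_itv; have [h|] := boolP (_ <= _ < _); last by rewrite mul0r.
  case/negP: x01; case/andP: h => -> h /=; apply: lt_le_trans h _.
  by rewrite -(inv_powers_beta hb) inv_powers_le// leq_subr.
rewrite iterS -IH transfer_in// /remainder_density.
rewrite -mulrDr mulrA -invfM -exprS; congr (_ * _).
rewrite big_mkcond sum_rcons [in RHS]big_mkcond [X in _ + X]big_mkcond.
rewrite -big_split /=; apply: eq_bigr => J _.
rewrite words_rcons_false words_rcons_true !trailing_ones_rcons.
have [Jw|_] := boolP (J \in words n m); last by rewrite /= addr0.
rewrite /=; have rJ := trailing_ones_lt m J Jw.
have x0 : 0 <= x by case/andP: x01.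
rewrite !word_value_rcons mul0r addr0 mul1r subn0 (inv_powers_beta hb).
rewrite !indic_itv x01 [LHS]addrC; congr (_ + _).
  have -> : 0 <= x / b < e (n - trailing_ones J).
    have := piece_div hb x x01; rewrite inv_powers0 => /andP[-> h] /=.
    by apply: lt_le_trans h _; rewrite inv_powers_le// subn_gt0.
  by congr (_ * f (_ + _)); rewrite exprS invfM -!mulrA [x * _]mulrC mulrCA.
rewrite -(subnSK rJ).
have -> : (0 <= (1 + x) / b < e (n - (trailing_ones J).+1).+1)%R
        = (x < e (n - (trailing_ones J).+1)).
  rewrite divr_ge0 ?addr_ge0 ?(ltW b0)//= ltr_pdivrMr// mulrC.
  by rewrite inv_powers_shift ?gt_eqF// ltrD2l.
rewrite x0 /=; case: ifPn => [_|h].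
  congr (_ * f _); rewrite exprS invfM; ring.
have -> : (n - (trailing_ones J).+1 = 0)%N by lia.
by rewrite inv_powers0 ltNge x0 mul0r.
Qed.
End Words.

(** * Integrals and the transfer operator *)

Section Measure.
Context {R : realType}.
Local Notation mu := (@lebesgue_measure R).
Implicit Types (A : set R) (h g : R -> R).

(** The integral is taken in the extended reals: for the nonnegative functions
considered here no integrability has to be carried along. *)
Definition mass A h : \bar R := \int[mu]_(x in A) (h x)%:E.

Lemma massE A h : mass A h = mass setT (fun x => \1_A x * h x).
Proof.
rewrite /mass integral_mkcond; apply: eq_integral => x _.
rewrite patchE indicE; case: (x \in A) => /=; by rewrite ?mul1r ?mul0r.
Qed.

Lemma measurable_affine_div (b c : R) : 0 < b ->
  measurable_fun setT (fun y : R => (y + c) / b).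
Proof.
move=> b0; apply: nondecreasing_measurable => // x y xy.
by rewrite ler_pM2r ?invr_gt0// lerD2r.
Qed.

Lemma measurable_affine_mul (b c : R) : 0 < b ->
  measurable_fun setT (fun y : R => b * y + c).
Proof.
move=> b0; apply: nondecreasing_measurable => // x y xy.
by rewrite lerD2r ler_pM2l.
Qed.

(** Lebesgue measure is the image, rescaled by [b^-1], of itself under
[y |-> (y + c) / b]: both agree on intervals. *)
Lemma mass_affine (b c : R) h : 0 < b -> measurable_fun setT h ->
  (forall x, 0 <= h x) ->
  mass setT h = mass setT (fun y => b^-1 * h ((y + c) / b)).
Proof.
move=> b0 mh h0.
have mphi := measurable_affine_div b c b0.
have bi0 : 0 <= b^-1 by rewrite invr_ge0 ltW.
pose phi := (fun y : R => (y + c) / b) : measurableTypeR R -> measurableTypeR R.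
pose nu_of := mscale (NngNum bi0) (pushforward mu phi)
  : {measure set (measurableTypeR R) -> \bar R}.
pose nu := nu_of mphi.
have E A : measurable A -> mu A = nu A.
  apply: lebesgue_measure_unique => _ [[u v] _ <-].
  pose B : set R := `]b * u - c, b * v - c]%classic.
  have -> : nu `]u, v]%classic = ((b^-1)%:E * mu B)%E.
    congr (_ * mu _)%E; apply/seteqP; split=> y; rewrite /B /= !in_itv /=;
    by rewrite ltr_pdivlMr// ler_pdivrMr// ltrBlDr lerBrDr ![_ * b]mulrC.
  rewrite /B !lebesgue_measure_itv /= !lte_fin ltrD2r ltr_pM2l//.
  case: ifP => _; last by rewrite mule0.
  rewrite -!EFinB -EFinM; congr EFin.
  have -> : b * v - c - (b * u - c) = b * (v - u) by ring.
  by rewrite mulKf ?gt_eqF.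
rewrite /mass (eq_measure_integral nu); last by move=> A mA _; exact: E.
rewrite /nu ge0_integral_mscale//=; last 2 first.
  exact/measurable_EFinP.
  by move=> x _; rewrite lee_fin.
rewrite ge0_integral_pushforward//; last 2 first.
  exact/measurable_EFinP.
  by move=> x _; rewrite lee_fin.
rewrite preimage_setT -ge0_integralZl_EFin//.
- by move=> x _; rewrite lee_fin.
- by apply/measurable_EFinP; exact: measurableT_comp.
Qed.

Lemma measurable_beta_map (b : R) : 0 < b -> measurable_fun setT (beta_map b).
Proof.
move=> b0; apply: measurable_funB; first exact: measurable_funM.
apply: nondecreasing_measurable => // x y xy.
by rewrite ler_int le_floor// ler_pM2l.
Qed.

Lemma measurable_transfer (b : R) h : 0 < b -> measurable_fun setT h ->
  measurable_fun setT (transfer b h).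
Proof.
move=> b0 mh; rewrite /transfer; apply: measurable_funM.
  exact: measurable_indic.
apply: measurable_funM; first exact: measurable_cst.
apply: measurable_funD; apply: (measurableT_comp mh).
  by have := measurable_affine_div b 0 b0; under eq_fun do rewrite addr0.
by have := measurable_affine_div b 1 b0; under eq_fun do rewrite addrC.
Qed.

Lemma measurable_iter_transfer (b : R) h k : 0 < b -> measurable_fun setT h ->
  measurable_fun setT (iter k (transfer b) h).
Proof. by move=> b0 mh; elim: k => //= k; exact: measurable_transfer. Qed.

(** On [0, 1) the map [beta_map b] has the two inverse branches
[y |-> y / b] and [y |-> (1 + y) / b]. *)
Lemma mass_transfer (b : R) h A : 1 < b < 2 -> measurable A ->
  measurable_fun setT h -> (forall x, 0 <= h x) -> supported h ->
  mass (beta_map b @^-1` A) h = mass A (transfer b h).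
Proof.
move=> /andP[b1 b2] mA mh h0 hs.
have b0 : 0 < b by exact: lt_trans b1.
have bn0 : b != 0 by rewrite gt_eqF.
pose u c x : R := \1_A (b * x - c) * one01 (b * x - c) * h x.
have mI c : measurable_fun setT (fun x : R => \1_A (b * x - c) * one01 (b * x - c)).
  apply: (measurableT_comp (f := fun x : R => \1_A x * one01 x)).
    by apply: measurable_funM; exact: measurable_indic.
  exact: measurable_affine_mul.
have mu' c : measurable_fun setT (u c) by apply: measurable_funM.
have u0 c x : 0 <= u c x by rewrite /u one01E indicE !mulr_ge0.
have -> : mass (beta_map b @^-1` A) h = mass setT (u 0) + mass setT (u 1).
  rewrite massE /mass -ge0_integralD//; last 4 first.
  - by move=> x _; rewrite lee_fin.
  - by apply/measurable_EFinP; exact: mu'.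
  - by move=> x _; rewrite lee_fin.
  - by apply/measurable_EFinP; exact: mu'.
  apply: eq_integral => x _; rewrite -EFinD; congr EFin.
  rewrite /u -mulrDl.
  have [/andP[x0 x1]|x01] := boolP (0 <= x < 1); last by rewrite hs// !mulr0.
  congr (_ * _); rewrite !one01E subr0.
  have bx0 : 0 <= b * x by apply: mulr_ge0 => //; exact: ltW.
  have bx2 : b * x < 2 by apply: le_lt_trans b2; apply: ler_piMr; exact: ltW.
  rewrite (_ : \1_(beta_map b @^-1` A) x = \1_A (beta_map b x))//.
  rewrite /beta_map; have [bx1|bx1] := ltP (b * x) 1.
    have -> : Num.floor (b * x) = 0 by apply/eqP; rewrite floor_eq bx0.
    by rewrite subr0 bx0 subr_ge0 leNgt bx1/= mulr1 mulr0 addr0.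
  have -> : Num.floor (b * x) = 1 by apply/eqP; rewrite floor_eq bx1.
  rewrite bx0 subr_ge0 bx1 /= mulr0 add0r.
  by rewrite (_ : (b * x - 1 < 1)%R = true) ?mulr1//; lra.
rewrite (mass_affine b 0)// (mass_affine b 1 (u 1))// [RHS]massE.
rewrite /mass -ge0_integralD//; last 4 first.
- by move=> x _; rewrite lee_fin mulr_ge0// invr_ge0 ltW.
- apply/measurable_EFinP; apply: measurable_funM; first exact: measurable_cst.
  exact: (measurableT_comp (mu' 0) (measurable_affine_div b 0 b0)).
- by move=> x _; rewrite lee_fin mulr_ge0// invr_ge0 ltW.
- apply/measurable_EFinP; apply: measurable_funM; first exact: measurable_cst.
  exact: (measurableT_comp (mu' 1) (measurable_affine_div b 1 b0)).
apply: eq_integral => x _; rewrite -EFinD; congr EFin.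
rewrite /u /transfer -/(one01 x) ![b * (_ / b)]mulrC !divfK// !addrK addr0.
by rewrite [x + 1]addrC; ring.
Qed.

Lemma mass_iter_transfer (b : R) h A k : 1 < b < 2 -> measurable A ->
  measurable_fun setT h -> (forall x, 0 <= h x) -> supported h ->
  mass (iter k (beta_map b) @^-1` A) h = mass A (iter k (transfer b) h).
Proof.
move=> b12 mA mh h0 hs; have b0 : 0 < b by case/andP: b12 => /(lt_trans _) ->.
elim: k A mA => [|k IH] A mA //=.
rewrite -mass_transfer//; last 3 first.
- exact: measurable_iter_transfer.
- exact: iter_transfer_ge0.
- exact: iter_transfer_supported.
by rewrite -IH// -[X in measurable X]setTI; exact: measurable_beta_map.
Qed.

End Measure.

Arguments mass {R} A%_classical_set_scope h%_ring_scope.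

Section MassOrder.
Context {R : realType}.
Implicit Types (A : set R) (h g : R -> R).

Lemma le_mass A h g : measurable A -> measurable_fun setT h ->
  measurable_fun setT g -> (forall x, 0 <= h x) -> (forall x, h x <= g x) ->
  (mass A h <= mass A g)%E.
Proof.
move=> mA mh mg h0 hg; apply: ge0_le_integral => //.
- by move=> x _; rewrite lee_fin.
- by apply/measurable_EFinP; exact: measurable_funTS.
- by apply/measurable_EFinP; exact: measurable_funTS.
- by move=> x _; rewrite lee_fin.
Qed.

Lemma massD A h g : measurable A -> measurable_fun setT h ->
  measurable_fun setT g -> (forall x, 0 <= h x) -> (forall x, 0 <= g x) ->
  mass A (fun x => h x + g x) = (mass A h + mass A g)%E.
Proof.
move=> mA mh mg h0 g0; rewrite /mass -ge0_integralD//.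
- by move=> x _; rewrite lee_fin.
- by apply/measurable_EFinP; exact: measurable_funTS.
- by move=> x _; rewrite lee_fin.
- by apply/measurable_EFinP; exact: measurable_funTS.
Qed.

Lemma massZ A (c : R) h : measurable A -> measurable_fun setT h ->
  (forall x, 0 <= h x) -> 0 <= c ->
  mass A (fun x => c * h x) = (c%:E * mass A h)%E.
Proof.
move=> mA mh h0 c0; rewrite /mass -ge0_integralZl_EFin//.
- by move=> x _; rewrite lee_fin.
- by apply/measurable_EFinP; exact: measurable_funTS.
Qed.

Lemma mass_subset A h : measurable A -> measurable_fun setT h ->
  (forall x, 0 <= h x) -> (mass A h <= mass setT h)%E.
Proof.
move=> mA mh h0; apply: ge0_subset_integral => //.
- by apply/measurable_EFinP.
- by move=> x _; rewrite lee_fin.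
Qed.

Lemma measurable_one01 : measurable_fun setT (@one01 R).
Proof. exact: measurable_indic. Qed.

Lemma one01_ge0 (x : R) : 0 <= one01 x.
Proof. by rewrite one01E. Qed.

Lemma mass_indic_itv (a c : R) : a <= c ->
  mass setT (fun x => \1_[set` `[a, c[] x) = (c - a)%:E.
Proof.
move=> ac; rewrite /mass integral_indic// setIT [LHS]lebesgue_measure_itv /= lte_fin.
rewrite lt_neqAle ac andbT; case: eqVneq => [->|_] /=; last by rewrite EFinB.
by rewrite subrr.
Qed.

(** Since [0, 1) has measure [1], a uniform bound there passes unchanged to the
integrals. *)
Lemma le_mass_unif A h g (delta : R) : measurable A -> measurable_fun setT h ->
  measurable_fun setT g -> (forall x, 0 <= h x) -> (forall x, 0 <= g x) ->
  supported h -> 0 <= delta ->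
  (forall x, 0 <= x < 1 -> h x <= g x + delta) ->
  (mass A h <= mass A g + delta%:E)%E.
Proof.
move=> mA mh mg h0 g0 hs d0 hg.
have md : measurable_fun setT (fun x : R => delta * one01 x).
  by apply: measurable_funM; [exact: measurable_cst|exact: measurable_one01].
have d1 (x : R) : 0 <= delta * one01 x by rewrite mulr_ge0 ?one01_ge0.
apply: (@le_trans _ _ (mass A (fun x => g x + delta * one01 x))).
  apply: le_mass => //; first exact: measurable_funD.
  move=> x; rewrite one01E; have [x01|x01] := boolP (0 <= x < 1).
    by rewrite mulr1 hg.
  by rewrite hs// mulr0 addr0.
rewrite massD// leeD2l//; apply: le_trans (mass_subset _ _ _ _ _) _ => //.
rewrite (massZ _ _ _ measurableT measurable_one01 one01_ge0 d0).
by rewrite mass_indic_itv// subr0 mule1.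
Qed.

Lemma measurable_step n (b : R) v : measurable_fun setT (step n b v).
Proof.
apply: measurable_sum => j; apply: measurable_funM; first exact: measurable_cst.
exact: measurable_indic.
Qed.

End MassOrder.

Section Core.
Context {R : realType} {n : nat} {b : R}.
Hypotheses (hn : (2 <= n)%N) (hb : nbonacci_base n b).
Let b0 : 0 < b := beta_gt0 hb.
Local Notation e := (inv_powers b).
Local Notation G := (parry_sum (n := n) (b := b)).
Local Notation D := (parry_const n b).
Let b12 : 1 < b < 2. Proof. by rewrite (beta_gt1 hn hb) (beta_lt2 hn hb). Qed.
Let G0 := parry_sum_ge0 hn hb.
Let Gs := parry_sum_supported hb.

Lemma measurable_parry_sum : measurable_fun setT G.
Proof. by rewrite parry_sumE//; exact: measurable_step. Qed.
Let mG := measurable_parry_sum.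

Lemma mass_parry_sum : mass setT G = D%:E.
Proof.
have Gfin : mass setT G \is a fin_num.
  rewrite ge0_fin_numE; last by apply: integral_ge0 => x _; rewrite lee_fin.
  apply: (@le_lt_trans _ _ (mass setT (fun=> 0%R) + b%:E)%E).
    apply: le_mass_unif => //; first exact: ltW.
    by move=> x x01; rewrite add0r; have /andP[] := parry_sum_bounds hn hb _ x01.
  by rewrite /mass integral0 add0e ltry.
have GE : mass setT G = mass [set` `[(0:R), 1[] G.
  rewrite [RHS]massE; congr mass; apply/funext => x; rewrite indic_itv.
  have [x01|x01] := boolP (0 <= x < 1); first by rewrite mul1r.
  by rewrite Gs// mulr0.
by rewrite -(fineK Gfin) GE.
Qed.

Lemma parry_const_ge1 : 1 <= D.
Proof.
rewrite -lee_fin -mass_parry_sum -[leLHS](_ : mass setT (@one01 R) = 1%:E).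
  apply: (le_mass _ _ _ measurableT measurable_one01 mG one01_ge0) => x.
  rewrite one01E; have [x01|x01] := boolP (0 <= x < 1); last exact: G0.
  by have /andP[] := parry_sum_bounds hn hb _ x01.
by rewrite mass_indic_itv// subr0.
Qed.

(** [T^m1 h] is within [2 * delta] of a step function [g] with nonnegative
entries, and [step_spectral] applies to [g]. It leaves the coefficient [A] of
[parry_sum] unknown; integrating both sides over [0, 1) shows that [A] is close
to the integral [s] of [h] divided by [parry_const], because [T] preserves
integrals. *)
Lemma transfer_spectral (rho K : R) : 0 < rho -> 0 <= K ->
  (forall w : nat -> R, (forall k, w (k + n)%N = \sum_(i < n) w (k + i)%N) ->
     exists A, forall k,
       `|w k - A * b ^+ k| <= K * (\sum_(i < n) `|w i|) * rho ^+ k) ->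
  exists2 C : R, 0 <= C & forall (h : R -> R) (s delta : R) m1 m2,
    measurable_fun setT h -> (forall x, 0 <= h x) -> supported h ->
    mass setT h = s%:E -> 0 <= delta ->
    (forall x y, 0 <= x < 1 -> 0 <= y < 1 -> `|x - y| <= b ^- m1 ->
       `|h x - h y| <= delta) ->
    (n <= m2)%N -> forall x, 0 <= x < 1 ->
    `|iter (m2 + m1) (transfer b) h x - s * parry_density n b x|
    <= C * (rho / b) ^+ m2 * (s + delta) + C * delta.
Proof.
move=> rho0 K0 /(step_spectral hn hb _ _ rho0 K0)[K1 K10 hK1].
(* With [eta] the error of [step_spectral], the total error is at most
   [8 * delta + 3 * eta], and [eta] is at most
   [2 * K1 * 2 ^+ n * (rho / b) ^+ m2 * (s + delta)]; both use [b < 2]. *)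
exists (8 + 6 * K1 * 2 ^+ n); first by rewrite addr_ge0// !mulr_ge0 ?exprn_ge0.
move=> h s delta m1 m2 mh h0 hs hms d0 osc nm2 x x01.
have /andP[b1 b2] := b12.
pose u := iter m1 (transfer b) h.
have mu_ : measurable_fun setT u by exact: measurable_iter_transfer.
have u0 y : 0 <= u y by exact: iter_transfer_ge0.
have us : supported u by exact: iter_transfer_supported.
have ums : mass setT u = s%:E by rewrite -mass_iter_transfer.
pose v := sample (n := n) (b := b) u; pose g := step n b v.
have vn : v n = 0 by rewrite /v /sample ltnn.
have v0 j : 0 <= v j by rewrite /v /sample; case: ifP.
have g0 y : 0 <= g y.
  by apply: sumr_ge0 => j _; rewrite indic_itv mulr_ge0.
have gs : supported g by exact: step_supported.
have mg : measurable_fun setT g by exact: measurable_step.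
have ug y : 0 <= y < 1 -> `|u y - g y| <= delta * b.
  by move=> y01; apply: (iter_transfer_sample hn hb).
have d20 : 0 <= delta * b by rewrite mulr_ge0// ltW.
have gu : (mass setT g <= s%:E + (delta * b)%:E)%E.
  rewrite -ums; apply: le_mass_unif => // y y01.
  by have := ug y y01; rewrite ler_distl => /andP[]; lra.
have ug' : (s%:E <= mass setT g + (delta * b)%:E)%E.
  rewrite -ums; apply: le_mass_unif => // y y01.
  by have := ug y y01; rewrite ler_distl => /andP[]; lra.
have [s' gs'] : exists s', mass setT g = s'%:E.
  exists (fine (mass setT g)); rewrite fineK// ge0_fin_numE.
    by apply: le_lt_trans gu _; rewrite -EFinD ltry.
  by apply: integral_ge0 => y _; rewrite lee_fin.
rewrite gs' -EFinD lee_fin in gu; rewrite gs' -EFinD lee_fin in ug'.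
(* Each entry of [v] is bounded by the mass of [g] over the length of its piece. *)
pose B := b ^+ n * (s + delta * b).
have vB j : 0 <= v j <= B.
  rewrite v0 /=; have [jn|nj] := ltnP j n; last first.
    rewrite /v /sample ltnNge nj /= /B mulr_ge0 ?exprn_ge0 ?(ltW b0)//.
    by apply: le_trans gu; rewrite -lee_fin -gs'; apply: integral_ge0 => y _; rewrite lee_fin.
  have : v j * (e j.+1 - e j) <= s'.
    rewrite -lee_fin -gs' EFinM -mass_indic_itv ?inv_powers_le//.
    have mi : measurable_fun setT (fun y => \1_[set` `[e j, e j.+1[] y : R).
      exact: measurable_indic.
    have i0 y : 0 <= \1_[set` `[e j, e j.+1[] y :> R by rewrite indic_itv.
    rewrite -(massZ _ _ _ measurableT mi i0)//; apply: le_mass => //.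
    - by apply: measurable_funM; first exact: measurable_cst.
    - by move=> y; rewrite mulr_ge0.
    - move=> y; rewrite indic_itv; have [yj|_] := boolP (e j <= y < e j.+1).
        by rewrite mulr1 /g (step_in hb _ j).
      by rewrite mulr0.
  rewrite inv_powersS addrC addKr ler_pdivrMr ?exprn_gt0// => h1.
  have s'0 : 0 <= s'.
    by rewrite -lee_fin -gs'; apply: integral_ge0 => y _; rewrite lee_fin.
  apply: le_trans h1 _; rewrite mulrC /B; apply: ler_pM => //.
    by rewrite exprn_ge0// ltW.
  by apply: ler_weXn2l => //; exact: ltW.
have s0 : 0 <= s by rewrite -lee_fin -hms; apply: integral_ge0 => y _; rewrite lee_fin.
have [A A0 hA] := hK1 v B vn vB.
pose eta := K1 * B * (rho / b) ^+ m2.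
have hAm := fun y => hA m2 y nm2.
have D1 := parry_const_ge1.
have AG : mass setT (fun y => A * G y) = (A * D)%:E.
  by rewrite massZ// mass_parry_sum EFinM.
have B0 : 0 <= B by have /andP[] := vB 0%N; exact: le_trans.
have r0 : 0 <= (rho / b) ^+ m2 by apply: exprn_ge0; apply: divr_ge0; exact: ltW.
have eta0 : 0 <= eta by rewrite /eta mulr_ge0// mulr_ge0.
have Tg : mass setT (iter m2 (transfer b) g) = s'%:E.
  by rewrite -gs' -mass_iter_transfer.
have h1 : s' <= A * D + eta.
  rewrite -lee_fin EFinD -Tg -AG; apply: le_mass_unif => //.
  - exact: measurable_iter_transfer.
  - by apply: measurable_funM; [exact: measurable_cst|].
  - exact: iter_transfer_ge0.
  - by move=> y; rewrite mulr_ge0.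
  - exact: iter_transfer_supported.
  - by move=> y y01; have := hAm y y01; rewrite -/eta ler_distl => /andP[]; lra.
have h2 : A * D <= s' + eta.
  rewrite -lee_fin EFinD -Tg -AG; apply: le_mass_unif => //.
  - by apply: measurable_funM; [exact: measurable_cst|].
  - exact: measurable_iter_transfer.
  - by move=> y; rewrite mulr_ge0.
  - exact: iter_transfer_ge0.
  - by move=> y /Gs ->; rewrite mulr0.
  - by move=> y y01; have := hAm y y01; rewrite -/eta ler_distl => /andP[]; lra.
have AD : `|A - s / D| <= eta + delta * b.
  have D0 : 0 < D by lra.
  have -> : A - s / D = (A * D - s) / D by rewrite mulrBl mulfK// gt_eqF.
  rewrite normrM normfV (gtr0_norm D0) ler_pdivrMr//.
  apply: (@le_trans _ _ (eta + delta * b)); first by rewrite ler_norml; lra.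
  by rewrite ler_peMr// addr_ge0.
have le1 (h1' h2' : R -> R) : supported h1' -> supported h2' ->
    (forall y, 0 <= y < 1 -> `|h1' y - h2' y| <= delta * b) ->
    iter m2 (transfer b) h1' x
    <= iter m2 (transfer b) h2' x + delta * b * iter m2 (transfer b) (@one01 R) x.
  move=> s1 s2 h12.
  have -> : iter m2 (transfer b) h2' x
      + delta * b * iter m2 (transfer b) (@one01 R) x
    = iter m2 (transfer b) (fun y => h2' y + delta * b * one01 y) x.
    by rewrite iter_transferD iter_transferZ.
  apply: le_iter_transfer => // y; rewrite one01E.
  have [y01|y01] := boolP (0 <= y < 1); last by rewrite s1// s2// mulr0 addr0.
  by have := h12 y y01; rewrite mulr1 ler_distl => /andP[]; lra.
have T1 := iter_transfer_one_le hn hb m2 x.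
have Tug : `|iter m2 (transfer b) u x - iter m2 (transfer b) g x| <= delta * b * b.
  have T2 : delta * b * iter m2 (transfer b) (@one01 R) x <= delta * b * b.
    by rewrite ler_wpM2l.
  have l1 := le1 u g us gs ug.
  have l2 : iter m2 (transfer b) g x
    <= iter m2 (transfer b) u x + delta * b * iter m2 (transfer b) (@one01 R) x.
    by apply: le1 => // y y01; rewrite distrC ug.
  by rewrite ler_distl; apply/andP; split; lra.
have Ag := hAm x x01; rewrite -/g -/eta in Ag.
have -> : iter (m2 + m1) (transfer b) h x - s * parry_density n b x =
    (iter m2 (transfer b) u x - iter m2 (transfer b) g x)
    + (iter m2 (transfer b) g x - A * G x) + (A - s / D) * G x.
  by rewrite iterD /parry_density -/(G x); ring.
have ADG : `|(A - s / D) * G x| <= (eta + delta * b) * b.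
  rewrite normrM (ger0_norm (G0 x)); apply: ler_pM => //.
  by have /andP[] := parry_sum_bounds hn hb x x01.
have bn2 : b ^+ n <= 2 ^+ n by rewrite lerXn2r ?nnegrE ?ltW.
set r := (rho / b) ^+ m2 in eta r0 eta0 h1 h2 AD Ag ADG *.
have etale : eta <= 2 * K1 * 2 ^+ n * (r * (s + delta)).
  have -> : 2 * K1 * 2 ^+ n * (r * (s + delta))
    = K1 * (2 ^+ n * (2 * (s + delta))) * r by ring.
  apply: ler_wpM2r => //; apply: ler_wpM2l => //; rewrite /B; apply: ler_pM => //.
  - by apply: exprn_ge0; exact: ltW.
  - exact: addr_ge0.
  have db2 : delta * b <= delta * 2 by apply: ler_wpM2l => //; exact: ltW.
  by lra.
have db : delta * b <= 2 * delta by rewrite mulrC; apply: ler_wpM2r => //; exact: ltW.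
have dbb : delta * b * b <= 4 * delta.
  apply: (@le_trans _ _ (2 * delta * b)); first by rewrite ler_wpM2r// ltW.
  have -> : 4 * delta = 2 * delta * 2 by ring.
  by rewrite ler_wpM2l ?mulr_ge0// ltW.
have etab : eta * b <= 2 * eta by rewrite mulrC ler_wpM2r// ltW.
apply: (@le_trans _ _ (8 * delta + 3 * eta)).
  apply: le_trans (ler_normD _ _) _; apply: le_trans (lerD (ler_normD _ _) (lexx _)) _.
  apply: le_trans (lerD (lerD Tug Ag) ADG) _; rewrite mulrDl; lra.
have rs0 : 0 <= r * (s + delta) by rewrite mulr_ge0// addr_ge0.
have Kd : 0 <= K1 * 2 ^+ n * delta by rewrite !mulr_ge0 ?exprn_ge0.
by lra.
Qed.
End Core.

(** * Convergence in total variation *)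

Section Approximation.
Context {R : realType}.
Local Notation mu := (@lebesgue_measure R).

(** Half of a radius that works at [x] for [eps / 2] works for [eps] at all points
near [x]; compactness of the segment then gives a common radius. *)
Lemma continuous_unif01 (g : R -> R) (eps : R) : continuous g -> 0 < eps ->
  exists2 eta : R, 0 < eta & forall x y, 0 <= x <= 1 -> `|x - y| < eta ->
    `|g x - g y| <= eps.
Proof.
move=> cg e0.
pose P (e x : R) := forall y, `|x - y| < e -> `|g x - g y| <= eps.
have [x /= x01|eta0 /= eta00] := (compact_near_coveringP _).1 (@segment_compact R 0 1) R 0^'+ P _.
  have e20 : 0 < eps / 2 by rewrite divr_gt0.
  have /cvgrPdist_lt/(_ _ e20)/nbhs_ballP[d /= d0 hd] := cg x.
  exists (ball x (d / 2), [set e | e < d / 2]); first split.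
  - by apply: nbhsx_ballx; rewrite divr_gt0.
  - by apply: nbhs_right_lt; rewrite divr_gt0.
  case=> x' e /= [xx' ed] y x'y; have -> : eps = eps / 2 + eps / 2 by lra.
  have -> : g x' - g y = (g x - g y) - (g x - g x') by ring.
  apply: le_trans (ler_normB _ _) (lerD _ _); apply/ltW/hd; rewrite /ball /= in xx' *.
    have -> : x - y = (x - x') + (x' - y) by ring.
    apply: le_lt_trans (ler_normD _ _) _; lra.
  lra.
move=> H; exists (eta0 / 2); first by rewrite divr_gt0.
have He : ball_ [eta Num.Def.normr] 0 eta0 (eta0 / 2).
  by rewrite /= sub0r normrN gtr0_norm; lra.
have He2 : 0 < eta0 / 2 by lra.
move=> x y x01 xy; have x01' : `[(0:R), 1]%classic x by rewrite /= in_itv.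
exact: (H _ He He2 x x01' y xy).
Qed.

Lemma expr_small (r e : R) : 0 <= r < 1 -> 0 < e ->
  exists N, forall k, (N <= k)%N -> r ^+ k < e.
Proof.
move=> /andP[r0 r1] e0.
have /cvgrPdist_lt/(_ _ e0)[N _ hN] : r ^+ k @[k --> \oo] --> (0 : R).
  by apply: cvg_expr; rewrite ger0_norm.
exists N => k Nk; apply: le_lt_trans (hN k Nk).
by rewrite /= sub0r normrN ler_norm.
Qed.

(** A continuous approximation of [f] in [L^1] may be truncated below at [0] and
cut off outside [0, 1): as [f] is nonnegative and vanishes there, the distance
to [f] does not increase. *)
Lemma continuous_approx (f : R -> R) (eps : R) : 0 < eps ->
  measurable_fun setT f -> (forall x, 0 <= f x) -> supported f ->
  (mass setT f < +oo)%E ->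
  exists h : R -> R, [/\ measurable_fun setT h, forall x, 0 <= h x, supported h,
    (mass setT (fun x => `|f x - h x|)%R <= eps%:E)%E &
    forall d, 0 < d -> exists2 eta : R, 0 < eta &
      forall x y, 0 <= x < 1 -> 0 <= y < 1 -> `|x - y| < eta ->
        `|h x - h y| <= d].
Proof.
move=> e0 mf f0 fs ffin.
have mE : measurable (`[0%R : R, 1%R[%classic : set R) by exact: measurable_itv.
have Efin : (mu `[0%R : R, 1%R[%classic < +oo)%E.
  by rewrite lebesgue_measure_itv /= lte_fin ltr01 -EFinB ltry.
have fint : mu.-integrable (`[0%R : R, 1%R[%classic : set R) (EFin \o f).
  apply/integrableP; split; first by apply/measurable_EFinP; exact: measurable_funTS.
  under eq_integral => x _ do rewrite /= ger0_norm//.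
  by apply: le_lt_trans (mass_subset _ _ _ _ _) ffin.
have [g_ [gc gi gcvg]] := approximation_continuous_integrable mE Efin fint.
have [k hk] : exists k, (mass `[0%R : R, 1%R[%classic (fun x => `|f x - g_ k x|)%R <= eps%:E)%E.
  have /fine_cvgP[gfin /cvgrPdist_lt/(_ _ e0) gsmall] := gcvg.
  near \oo => k; exists k.
  have kfin : mass `[0%R : R, 1%R[%classic (fun x => `|f x - g_ k x|) \is a fin_num.
    by near: k.
  rewrite -(fineK kfin) lee_fin; apply: le_trans (ler_norm _) (ltW _).
  by rewrite -normrN -sub0r; near: k.
have mg : measurable_fun setT (g_ k) by exact: continuous_measurable_fun.
pose h x := Num.max (g_ k x) 0 * one01 x.
have mh : measurable_fun setT h.
  apply: measurable_funM; last exact: measurable_one01.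
  by apply: measurable_maxr => //; exact: measurable_cst.
exists h; split => //.
- by move=> x; rewrite /h mulr_ge0 ?one01_ge0// le_max lexx orbT.
- by move=> x /negPf x01; rewrite /h one01E x01 mulr0.
- apply: le_trans hk; rewrite [leRHS]massE; apply: le_mass => //.
  + by apply: measurableT_comp => //; exact: measurable_funB.
  + apply: measurable_funM; first exact: measurable_indic.
    by apply: measurableT_comp => //; exact: measurable_funB.
  + move=> x; rewrite /h indic_itv one01E; have [x01|x01] := boolP (0 <= x < 1).
      rewrite mulr1 mul1r; have [//|gx] := leP 0 (g_ k x).
      by rewrite subr0 ger0_norm// ler_normr; apply/orP; left; lra.
    by rewrite fs// !mulr0 mul0r subrr normr0.
move=> d d0; have [eta eta0 H] := continuous_unif01 _ _ (gc k) d0.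
exists eta => // x y x01 y01 xy; rewrite /h !one01E x01 y01 !mulr1.
have : `|g_ k x - g_ k y| <= d.
  by apply: H => //; case/andP: x01 => -> /ltW.
apply: le_trans.
set t := `|g_ k x - g_ k y|.
have t1 : g_ k x - g_ k y <= t by exact: ler_norm.
have t2 : g_ k y - g_ k x <= t by rewrite /t distrC ler_norm.
have t0 : 0 <= t by exact: normr_ge0.
by rewrite ler_norml; case: (leP 0 (g_ k x)); case: (leP 0 (g_ k y)); lra.
Unshelve. all: by end_near.
Qed.

End Approximation.

Section Final.
Context {R : realType} {n : nat} {b : R}.
Hypotheses (hn : (2 <= n)%N) (hb : nbonacci_base n b).
Let b0 : 0 < b := beta_gt0 hb.
Let b12 : 1 < b < 2. Proof. by rewrite (beta_gt1 hn hb) (beta_lt2 hn hb). Qed.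
Let D1 := parry_const_ge1 hn hb.

Lemma parry_density_ge0 x : 0 <= parry_density n b x.
Proof.
rewrite /parry_density mulr_ge0 ?(parry_sum_ge0 hn hb)// invr_ge0.
exact: le_trans D1.
Qed.

Lemma parry_density_supported : supported (parry_density n b).
Proof.
by move=> x x01; rewrite /parry_density -/(parry_sum (n := n) (b := b) x)
  (parry_sum_supported hb)// mulr0.
Qed.

Lemma measurable_parry_density : measurable_fun setT (parry_density n b).
Proof.
apply: measurable_funM; first exact: measurable_cst.
exact: measurable_parry_sum hb.
Qed.

Lemma mass_parry_density : mass setT (parry_density n b) = 1%:E.
Proof.
rewrite massZ ?(mass_parry_sum hn hb) -?EFinM ?mulVf ?gt_eqF//.
- exact: lt_le_trans D1.
- exact: measurable_parry_sum hb.
- exact: parry_sum_ge0.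
- by rewrite invr_ge0; exact: le_trans D1.
Qed.

(** Let [h] be uniformly continuous and close to [f] in [L^1]. The iterates of
[h] converge uniformly to a multiple of [f_beta], and those of [f] stay as close
to them in [L^1] as [f] is to [h]. *)
Lemma transfer_cvg_TV (f : R -> R) : measurable_fun setT f ->
  (forall x, 0 <= f x) -> supported f -> mass setT f = 1%:E ->
  forall eps, 0 < eps -> exists N, forall m, (N <= m)%N ->
  forall B, measurable B ->
    (mass B (iter m (transfer b) f) <= mass B (parry_density n b) + eps%:E)%E /\
    (mass B (parry_density n b) <= mass B (iter m (transfer b) f) + eps%:E)%E.
Proof.
move=> mf f0 fs f1 eps e0.
have [rho [K [/andP[rho0 rhob] K0 _ spec]]] := nbonacci_spectral hn hb.
have [C C0 hC] := transfer_spectral hn hb rho K rho0 K0 spec.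
(* With [e1] the accuracy in each approximation, the errors are [e1] for
   replacing [f] by [h], [e1] for replacing the integral of [h] by [1], and
   [(1 + C) * e1] from [transfer_spectral]. *)
pose e1 := Num.min 1 (eps / (3 + C)).
have C30 : 0 < 3 + C by rewrite ltr_wpDr.
have e10 : 0 < e1 by rewrite lt_min ltr01 divr_gt0.
have e11 : e1 <= 1 by rewrite ge_min lexx.
have e1e : (3 + C) * e1 <= eps.
  by rewrite mulrC -ler_pdivlMr// ge_min lexx orbT.
have [|h [mh h0 hs hf hunif]] := continuous_approx f e1 e10 mf f0 fs.
  by rewrite f1 ltry.
have mfh : measurable_fun setT (fun x => `|f x - h x|).
  by apply: measurableT_comp => //; exact: measurable_funB.
have fh : (mass setT f <= mass setT h + e1%:E)%E.
  apply: le_trans (leeD2l _ hf); rewrite -massD//; apply: le_mass => //.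
    exact: measurable_funD.
  by move=> x; rewrite -lerBlDl ler_norm.
have hf' : (mass setT h <= mass setT f + e1%:E)%E.
  apply: le_trans (leeD2l _ hf); rewrite -massD//; apply: le_mass => //.
    exact: measurable_funD.
  by move=> x; rewrite -lerBlDl distrC ler_norm.
have [s hms] : exists s, mass setT h = s%:E.
  exists (fine (mass setT h)); rewrite fineK// ge0_fin_numE.
    by apply: le_lt_trans hf' _; rewrite f1 -EFinD ltry.
  by apply: integral_ge0 => y _; rewrite lee_fin.
rewrite hms f1 -EFinD lee_fin in fh; rewrite hms f1 -EFinD lee_fin in hf'.
have [eta eta0 osc] := hunif e1 e10.
have [m1 hm1] : exists m1, b ^- m1 < eta.
  have [|N hN] := expr_small b^-1 eta _ eta0; last first.
    by exists N; rewrite -exprVn hN.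
  rewrite invr_ge0 ltW//= invf_lt1//.
  by case/andP: b12.
have [N hN] : exists N, forall k, (N <= k)%N -> 3 * C * (rho / b) ^+ k <= e1.
  have C1 : 0 < 3 * C + 1 by rewrite ltr_wpDl// mulr_ge0.
  have r01 : 0 <= rho / b < 1.
    by rewrite ltr_pdivrMr// mul1r rhob andbT divr_ge0// ltW.
  have [N hN] := expr_small (rho / b) (e1 / (3 * C + 1)) r01 (divr_gt0 e10 C1).
  exists N => k /hN; rewrite ltr_pdivlMr// => /ltW; apply: le_trans.
  rewrite mulrC ler_wpM2l ?lerDl//.
  by apply: exprn_ge0; case/andP: r01.
exists (N + n + m1)%N => m hm B mB.
pose m2 := (m - m1)%N.
have mE : m = (m2 + m1)%N by rewrite subnK// (leq_trans _ hm)// leq_addl.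
have Nnm2 : (N + n <= m2)%N by rewrite -(leq_add2r m1) -mE.
have nm2 : (n <= m2)%N by exact: leq_trans (leq_addl _ _) Nnm2.
have Nm2 : (N <= m2)%N by exact: leq_trans (leq_addr _ _) Nnm2.
pose kappa := (1 + C) * e1.
have k0 : 0 <= kappa by rewrite mulr_ge0// ?addr_ge0// ltW.
pose M := fine (mass B (parry_density n b)).
have M1 : (mass B (parry_density n b) <= 1%:E)%E.
  rewrite -mass_parry_density; apply: mass_subset => //.
    exact: measurable_parry_density.
  exact: parry_density_ge0.
have M0 : (0 <= mass B (parry_density n b))%E.
  by apply: integral_ge0 => y _; rewrite lee_fin parry_density_ge0.
have ME : mass B (parry_density n b) = M%:E.
  by rewrite fineK// ge0_fin_numE//; apply: le_lt_trans M1 _; rewrite ltry.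
rewrite ME in M0 M1 *; rewrite !lee_fin in M0 M1.
have s0 : 0 <= s.
  by rewrite -lee_fin -hms; apply: integral_ge0 => y _; rewrite lee_fin.
have main x : 0 <= x < 1 ->
    `|iter m (transfer b) h x - s * parry_density n b x| <= kappa.
  move=> x01; rewrite mE.
  have osc' x' y : 0 <= x' < 1 -> 0 <= y < 1 -> `|x' - y| <= b ^- m1 ->
      `|h x' - h y| <= e1.
    by move=> x'01 y01 xy; apply: osc => //; exact: le_lt_trans hm1.
  apply: le_trans (hC h s e1 m1 m2 mh h0 hs hms (ltW e10) osc' nm2 x x01) _.
  have r0 : 0 <= (rho / b) ^+ m2 by apply: exprn_ge0; apply: divr_ge0; exact: ltW.
  have rN := hN _ Nm2.
  have : C * (rho / b) ^+ m2 * (s + e1) <= C * (rho / b) ^+ m2 * 3.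
    by apply: ler_wpM2l; [exact: mulr_ge0 | lra].
  by rewrite /kappa; lra.
have sM : mass B (fun x => s * parry_density n b x) = (s * M)%:E.
  rewrite massZ// ?ME//; first exact: measurable_parry_density.
  exact: parry_density_ge0.
have mT (u : R -> R) : measurable_fun setT u -> measurable_fun setT (iter m (transfer b) u).
  exact: measurable_iter_transfer.
have T0 (u : R -> R) : (forall x, 0 <= u x) -> forall x, 0 <= iter m (transfer b) u x.
  exact: iter_transfer_ge0.
have hB1 : (mass B (iter m (transfer b) h) <= (s * M + kappa)%:E)%E.
  rewrite EFinD -sM; apply: le_mass_unif => //.
  - exact: mT.
  - by apply: measurable_funM; [exact: measurable_cst|exact: measurable_parry_density].
  - exact: T0.
  - by move=> x; rewrite mulr_ge0// parry_density_ge0.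
  - exact: iter_transfer_supported.
  - by move=> x x01; have := main x x01; rewrite ler_distl => /andP[]; lra.
have hB2 : ((s * M)%:E <= mass B (iter m (transfer b) h) + kappa%:E)%E.
  rewrite -sM; apply: le_mass_unif => //.
  - by apply: measurable_funM; [exact: measurable_cst|exact: measurable_parry_density].
  - exact: mT.
  - by move=> x; rewrite mulr_ge0// parry_density_ge0.
  - exact: T0.
  - by move=> x /parry_density_supported ->; rewrite mulr0.
  - by move=> x x01; have := main x x01; rewrite ler_distl => /andP[]; lra.
have Tle (u w : R -> R) : measurable_fun setT u -> measurable_fun setT w ->
   (forall x, 0 <= u x) -> (forall x, 0 <= w x) ->
   (forall x, u x <= w x + `|f x - h x|) ->
   (mass B (iter m (transfer b) u) <= mass B (iter m (transfer b) w) + e1%:E)%E.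
  move=> mu_ mw u0 w0 uw.
  apply: (@le_trans _ _ (mass B (iter m (transfer b) w)
                       + mass B (iter m (transfer b) (fun x => `|f x - h x|)%R))%E).
    rewrite -massD; [|by []|exact: mT|exact: mT|exact: T0|exact: T0].
    rewrite -iter_transferD; apply: le_mass => //.
    - exact: mT.
    - by apply: mT; exact: measurable_funD.
    - exact: T0.
    - exact: le_iter_transfer.
  rewrite leeD2l//; apply: le_trans _ hf.
  apply: (@le_trans _ _ (mass setT (iter m (transfer b) (fun x => `|f x - h x|)%R))).
    by apply: mass_subset => //; [exact: mT|exact: T0].
  rewrite -mass_iter_transfer// => x x01.
  by rewrite fs// hs// subrr normr0.
have sM1 : s * M <= M + e1.
  have : (s - 1) * M <= e1 * 1 by apply: (@le_trans _ _ (e1 * M));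
    [apply: ler_wpM2r => //; lra | apply: ler_wpM2l => //; exact: ltW].
  by rewrite mulrBl; lra.
have sM2 : M <= s * M + e1.
  have : (1 - s) * M <= e1 * 1 by apply: (@le_trans _ _ (e1 * M));
    [apply: ler_wpM2r => //; lra | apply: ler_wpM2l => //; exact: ltW].
  by rewrite mulrBl; lra.
have ke : kappa + 2 * e1 <= eps by rewrite /kappa; lra.
split.
  apply: le_trans (Tle f h mf mh f0 h0 _) _.
    by move=> x; rewrite -lerBlDl ler_norm.
  apply: le_trans (leeD2r _ hB1) _.
  by rewrite -!EFinD lee_fin; lra.
have hT : (mass B (iter m (transfer b) h)
         <= mass B (iter m (transfer b) f) + e1%:E)%E.
  by apply: Tle => // x; rewrite -lerBlDl distrC ler_norm.
apply: (@le_trans _ _ ((s * M)%:E + e1%:E)%E); first by rewrite -EFinD lee_fin.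
apply: le_trans (leeD2r _ (le_trans hB2 (leeD2r _ hT))) _.
move: (mass B _) => Y; rewrite -!addeA leeD2l// -!EFinD lee_fin; lra.
Qed.

End Final.

(** * From densities to laws *)

Lemma dTV01_le (R : realType) (P Q : set R -> \bar R) (eps : R) : 0 <= eps ->
  (forall B : set R, measurable B -> Q B \is a fin_num) ->
  (forall B : set R, measurable B -> B `<=` [set` `[0, 1[] ->
     (P B <= Q B + eps%:E)%E /\ (Q B <= P B + eps%:E)%E) ->
  (dTV01 P Q <= eps%:E)%E.
Proof.
move=> e0 Qfin PQ; apply: ge_ereal_sup => _ [B [mB B01] <-].
have [] := PQ B mB B01; rewrite -(fineK (Qfin B mB)).
case: (P B) => [p| |].
- rewrite -!EFinD !lee_fin => h1 h2.
  by rewrite ler_norml; apply/andP; split; lra.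
- by rewrite -EFinD leye_eq.
- by rewrite addNye leeNy_eq.
Qed.

Lemma dTV01_ge0 (R : realType) (P Q : set R -> \bar R) : (0 <= dTV01 P Q)%E.
Proof.
apply: (@le_trans _ _ (`|P set0 - Q set0|)%E); first exact: abse_ge0.
by apply: ereal_sup_ubound; exists set0 => //; split=> //; exact: sub0set.
Qed.

Lemma cvge0_small (R : realType) (u : nat -> \bar R) :
  (forall m, 0 <= u m)%E ->
  (forall eps : R, 0 < eps -> exists N, forall m, (N <= m)%N -> (u m <= eps%:E)%E) ->
  u m @[m --> \oo] --> (0 : \bar R).
Proof.
move=> u0 small; apply/fine_cvgP; split.
  have [N hN] := small 1 ltr01; exists N => // m /= /hN um.
  by rewrite ge0_fin_numE//; apply: le_lt_trans um _; rewrite ltry.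
apply/cvgrPdist_le => eps e0; have [N hN] := small eps e0.
exists N => // m /= /hN um; rewrite sub0r normrN ger0_norm ?fine_ge0//.
rewrite -lee_fin fineK// ge0_fin_numE//.
by apply: le_lt_trans um _; rewrite ltry.
Qed.

Lemma density01_supported (R : realType) (d : measure_display)
  (T : measurableType d) (P : probability T R) (X : {RV P >-> R}) (f : R -> R) :
  density01 X f -> supported f.
Proof. by case=> _ _ hs _ x x01; apply: hs; rewrite in_itv. Qed.

Lemma density01_mass (R : realType) (d : measure_display)
  (T : measurableType d) (P : probability T R) (X : {RV P >-> R}) (f : R -> R) :
  density01 X f -> mass setT f = 1%:E.
Proof. by case=> _ _ _ Pf; rewrite /mass -Pf// probability_setT. Qed.

Lemma remainder_lawE (R : realType) (d : measure_display)
  (T : measurableType d) (P : probability T R) (X : {RV P >-> R}) (f : R -> R)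
  (b : R) m (B : set R) :
  1 < b < 2 -> density01 X f -> measurable B ->
  remainder_law X b m B = mass B (iter m (transfer b) f).
Proof.
move=> b12 Xf mB; have [mf f0 _ Pf] := Xf.
have b0 : 0 < b by case/andP: b12 => /(lt_trans _) ->.
rewrite -mass_iter_transfer//; last exact: density01_supported Xf.
rewrite /mass -Pf//.
have mt : measurable_fun setT (iter m (beta_map b)).
  elim: m => [|m IH]; first exact: measurable_id.
  exact: measurableT_comp (measurable_beta_map b b0) IH.
by rewrite -[X in measurable X]setTI; exact: mt.
Qed.

Theorem theorem1p1 (R : realType) (n : nat) (hn : (2 <= n)%N) :
  exists C : R,
    forall (beta : R), nbonacci_base n beta ->
    forall (d : measure_display) (T : measurableType d) (P : probability T R)
      (X : {RV P >-> R}) (f : R -> R), density01 X f ->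
    (dTV01 (remainder_law X beta m) (parry_law n beta) @[m --> \oo]
       --> (0 : \bar R)) /\
    (forall (lambda2 : R[i]), second_largest_root n lambda2 ->
     forall L : R, L.-lipschitz_[set` `[(0 : R), 1[] f ->
     forall m : nat, (2 * n < m)%N ->
     forall m1 m2 : nat, (2 * n - 1 < m2)%N -> (n - 1 <= m1)%N ->
       (m1 + m2)%N = m ->
       (sup_dist01 (remainder_density n beta f m) (parry_density n beta)
        <= (C * normc ((beta%:C)%C^-1 * lambda2) ^+ m2
            + C * beta ^- m1 * L)%:E)%E).
Proof.
(* There is at most one [beta], so the constant may be built from it. *)
have [[b hb]|nob] := pselect (exists b : R, nbonacci_base n b); last first.
  by exists 0 => beta hbeta; case: nob; exists beta.
have [rho [K [/andP[rho0 rhob] K0 hrho spec]]] := nbonacci_spectral hn hb.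
have [C C0 hC] := transfer_spectral hn hb rho K rho0 K0 spec.
(* The factor [2] absorbs the product of the two error terms, since
   [rho / b <= 1]. *)
exists (2 * C) => beta hbeta.
have {beta hbeta} -> : beta = b.
  by apply: (root_real_pos hn hb); [exact: beta_gt0 hbeta|exact: root_beta hbeta].
move=> d T P X f Xf; have [mf f0 _ _] := Xf.
have fs := density01_supported _ _ _ _ _ _ Xf.
have f1 := density01_mass _ _ _ _ _ _ Xf.
have b0 := beta_gt0 hb.
have b12 : 1 < b < 2 by rewrite (beta_gt1 hn hb) (beta_lt2 hn hb).
split.
  apply: cvge0_small => [m|eps e0]; first exact: dTV01_ge0.
  have [N hN] := transfer_cvg_TV hn hb f mf f0 fs f1 eps e0.
  exists N => m Nm; apply: dTV01_le; first exact: ltW.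
    move=> B mB; rewrite /parry_law -/(mass B (parry_density n b)).
    rewrite ge0_fin_numE; last first.
      by apply: integral_ge0 => x _; rewrite lee_fin (parry_density_ge0 hn hb).
    apply: (@le_lt_trans _ _ (mass setT (parry_density n b))).
      apply: mass_subset => //; first exact: measurable_parry_density hb.
      exact: parry_density_ge0 hn hb.
    by rewrite (mass_parry_density hn hb) ltry.
  by move=> B mB _; rewrite (remainder_lawE _ _ _ _ _ _ _ _ _ b12 Xf mB); exact: hN.
move=> lambda2 hl L hL m _ m1 m2 hm2 _ <-.
have lip x y : 0 <= x < 1 -> 0 <= y < 1 -> `|f x - f y| <= L * `|x - y|.
  by move=> x01 y01; apply: (hL (x, y)); split; rewrite /= in_itv.
have L0 : 0 <= L.
  have /le_trans -/(_ _ (lip 0 2^-1 _ _)) := normr_ge0 (f 0 - f 2^-1).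
  rewrite sub0r normrN pmulr_lge0 ?normr_gt0//; apply; lra.
pose delta := b ^- m1 * L.
have d0 : 0 <= delta by rewrite mulr_ge0// invr_ge0 exprn_ge0// ltW.
have r0 : 0 <= rho / b by rewrite divr_ge0// ltW.
have nm2 : (n <= m2)%N by lia.
apply: ge_ereal_sup => _ [x /= x01 <-].
rewrite in_itv /= in x01.
rewrite (remainder_densityE hn hb)// addnC.
have osc y z : 0 <= y < 1 -> 0 <= z < 1 -> `|y - z| <= b ^- m1 ->
    `|f y - f z| <= delta.
  by move=> y01 z01 yz; apply: le_trans (lip _ _ y01 z01) _;
    rewrite /delta mulrC ler_wpM2r.
rewrite lee_fin.
have := hC f 1 delta m1 m2 mf f0 fs f1 d0 osc nm2 x x01.
rewrite mul1r => /le_trans; apply.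
have rl : (rho / b) ^+ m2 <= normc ((b%:C)%C^-1 * lambda2) ^+ m2.
  rewrite normcM normcV normc_real (gtr0_norm b0) [b^-1 * _]mulrC.
  have h : rho / b <= normc lambda2 / b by rewrite ler_pM2r ?invr_gt0// hrho.
  by apply: lerXn2r => //; rewrite nnegrE//; exact: le_trans h.
have r1 : (rho / b) ^+ m2 <= 1.
  by rewrite exprn_ile1// ler_pdivrMr// mul1r ltW.
have Cr : C * (rho / b) ^+ m2 <= C * normc ((b%:C)%C^-1 * lambda2) ^+ m2.
  by rewrite ler_wpM2l.
have Crd : C * (rho / b) ^+ m2 * delta <= C * delta.
  by rewrite ler_wpM2r// ler_piMr.
have Cn : 0 <= C * (rho / b) ^+ m2 by rewrite mulr_ge0// exprn_ge0.
have -> : 2 * C * b ^- m1 * L = 2 * (C * delta) by rewrite /delta; ring.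
by lra.
Qed.
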